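(* For every $\epsilon > 0$ and every positive integer $n$, every $n\times n$ complex self-adjoint matrix $T$ with zero diagonal can be $(r,\epsilon)$-paved with $r = \lceil (6/\epsilon)^4 \rceil$.
   Context: A square $n \times n$ matrix $T$ can be $(r,\epsilon)$-paved if there are coordinate projections $P_1,\dots,P_r$ (diagonal $n\times n$ matrices with diagonal entries in $\{0,1\}$, possibly zero) such that $\sum_{i=1}^r P_i = I$ and $\|P_i T P_i\| \le \epsilon \|T\|$ for all $i$, where $\|\cdot\|$ is the operator norm. *)

(* Defs.v *)
From mathcomp Require Import all_boot all_order all_algebra.
From mathcomp Require Import complex.
From mathcomp Require Import boolp classical_sets reals.

Set Implicit Arguments.
Unset Strict Implicit.
Unset Printing Implicit Defensive.

Import Order.TTheory GRing.Theory Num.Theory.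

Local Open Scope ring_scope.
Local Open Scope classical_set_scope.

Section Paving.
Variables (R : realType) (n : nat).

(* Euclidean norm on C^n, valued in R rather than in R[i]. *)
Definition l2norm (x : 'cV[R[i]]_n) : R :=
  Num.sqrt (\sum_(i < n) ComplexField.Normc.normc (x i 0) ^+ 2).

Definition opnorm (A : 'M[R[i]]_n) : R :=
  sup [set l2norm (A *m x) | x in [set x : 'cV[R[i]]_n | l2norm x <= 1]].

Definition coord_proj (P : 'M[R[i]]_n) : Prop :=
  is_diag_mx P /\ forall i : 'I_n, P i i = 0 \/ P i i = 1.

Definition can_be_paved (r : nat) (eps : R) (T : 'M[R[i]]_n) : Prop :=
  exists P : 'I_r -> 'M[R[i]]_n,
    [/\ forall k, coord_proj (P k),
        \sum_(k < r) P k = 1%:M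
      & forall k, opnorm (P k *m T *m P k) <= eps * opnorm T].

End Paving.

(* Main.v *)
Require Import Defs.
From mathcomp Require Import all_boot all_order all_algebra.
From mathcomp Require Import complex.
From mathcomp Require Import boolp classical_sets reals.
From mathcomp Require Import cauchyreals zify ring lra.
(* Imported again so that [set0], [setT] and their lemmas refer to finite sets. *)
From mathcomp Require Import all_boot all_order all_algebra complex.

(** The proof runs the interlacing-families argument of Marcus, Spielman and
    Srivastava directly on determinants.  For a Hermitian contraction [A] with
    zero diagonal and [r] colours, give every index [i] one variable [z (i, k)]
    per colour and let [P] be the product over the colours [k] of
    [det (diag (z (., k)) - A)].  Differentiating [P] in all the variables
    [(i, k)] with [k <> sigma i], and then setting all variables to [x], yields
    the product of the characteristic polynomials of the blocks of [A] cut out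
    by the colouring [sigma].  Summing over all [sigma] amounts to applying one
    operator [avg] per index.

    [P] is multi-affine and none of its derivatives vanishes when all the
    variables lie in the upper half plane; [avg] preserves this.  It follows that
    one index at a time a colour can be chosen without increasing the largest
    root, so that some colouring does at least as well as the average.  A barrier
    argument bounds the largest root of the average: if the barrier of each
    variable at [b] is at most [1 / s], then each [avg] allows to lower the
    variables of its row by [s (1 - 2 / r)].  Since [A] has zero diagonal,
    [s = b - 1 / b] is admissible, and the blocks of [A] have top eigenvalue
    below [1 / b + 2 (b - 1 / b) / r].

    With [b = 3 / eps] and [r = floor (36 / eps ^ 2)] this is at most [eps].
    Refining the colourings obtained for [A] and [- A] gives
    [r ^ 2 <= (6 / eps) ^ 4] blocks of norm at most [eps]. *)

Set Implicit Arguments.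
Unset Strict Implicit.
Unset Printing Implicit Defensive.
Import Order.TTheory GRing.Theory Num.Theory.

Local Open Scope ring_scope.

Local Notation rec := (@complex.Re _).
Local Notation imc := (@complex.Im _).
Local Notation cj := (@conjc _).

(** * Complex numbers *)

Section ComplexFacts.
Variable R : rcfType.
Local Open Scope complex_scope.
Implicit Types (x y z : R[i]).

Lemma ImcD x y : imc (x + y) = imc x + imc y.
Proof. by case: x y => [a b] [c d]. Qed.

Lemma ImcN x : imc (- x) = - imc x.
Proof. by case: x. Qed.

Lemma ImcB x y : imc (x - y) = imc x - imc y.
Proof. by rewrite ImcD ImcN. Qed.

Lemma Imc_sum I (r : seq I) (P : pred I) (F : I -> R[i]) :
  imc (\sum_(i <- r | P i) F i) = \sum_(i <- r | P i) imc (F i).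
Proof. by apply: (big_morph _ ImcD). Qed.

Lemma ImcJ x : imc (cj x) = - imc x.
Proof. by case: x. Qed.

Lemma ImcZ (a : R) x : imc (a%:C * x) = a * imc x.
Proof. by case: x => c d; rewrite /= mul0r addr0. Qed.

Lemma conjcM x y : (cj (x * y)) = cj x * cj y.
Proof. exact: (rmorphM (@conjc R)). Qed.

Lemma conjcD x y : (cj (x + y)) = cj x + cj y.
Proof. exact: (rmorphD (@conjc R)). Qed.

Lemma conjc_sum I (r : seq I) (P : pred I) (F : I -> R[i]) :
  cj (\sum_(i <- r | P i) F i) = \sum_(i <- r | P i) cj (F i).
Proof. by apply: (big_morph _ conjcD); rewrite conjc0. Qed.

Definition normc2 x : R := rec x ^+ 2 + imc x ^+ 2.

Lemma mulcJ x : x * cj x = (normc2 x)%:C.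
Proof.
case: x => a b; apply/eqP; rewrite eq_complex /= /normc2 /=.
by apply/andP; split; apply/eqP; ring.
Qed.

Lemma normc2_ge0 x : 0 <= normc2 x.
Proof. by rewrite addr_ge0 ?sqr_ge0. Qed.

Lemma normc2_eq0 x : (normc2 x == 0) = (x == 0).
Proof.
by case: x => a b; rewrite paddr_eq0 ?sqr_ge0 // !sqrf_eq0 eq_complex.
Qed.

Lemma normc2_gt0 x : (0 < normc2 x) = (x != 0).
Proof. by rewrite lt0r normc2_eq0 normc2_ge0 andbT. Qed.

Lemma Imc_div x y : y != 0 -> imc (x / y) = imc (x * cj y) / normc2 y.
Proof.
move=> y0; have n0 : normc2 y != 0 by rewrite normc2_eq0.
have -> : x / y = (normc2 y)^-1%:C * (x * cj y).
  apply: (mulIf y0); rewrite divfK // -[x in LHS]mul1r.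
  have -> : 1 = ((normc2 y)^-1 * normc2 y)%:C :> R[i] by rewrite mulVf.
  by rewrite rmorphM /= -mulcJ; ring.
by rewrite ImcZ mulrC.
Qed.

Lemma poly_ge0_at0 (p : {poly R}) : (forall t, 0 < t -> 0 <= p.[t]) -> 0 <= p.[0].
Proof.
move=> p_ge0; rewrite leNgt; apply/negP => p0.
set B := poly_accr_bound p 0 1.
have B0 : 0 < B by exact: poly_accr_bound_gt0.
have B2 : 0 < 2 * B by lra.
(* [B] is a Lipschitz constant for [p] near 0, so moving by this [t] changes [p] by at most half of
   [- p.[0]]. *)
pose t := Num.min 1 (- p.[0] / (2 * B)).
have t0 : 0 < t by rewrite lt_min ltr01 divr_gt0 // oppr_gt0.
have t1 : `|t - 0| <= 1 by rewrite subr0 gtr0_norm // ge_min lexx.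
have := @poly_accr_bound1P _ p 0 1 0 t _ t1; rewrite subrr normr0 ler01 subr0 => /(_ isT).
rewrite (gtr0_norm t0) => H.
have tB : t * B <= - p.[0] / 2.
  have : t <= - p.[0] / (2 * B) by rewrite ge_min lexx orbT.
  by rewrite ler_pdivlMr // => ?; lra.
have := le_trans (ler_norm _) (le_trans H tB); have := p_ge0 _ t0; lra.
Qed.

(** On the real axis the imaginary part of [p] is itself a real polynomial, namely [q]. Inequalities
    in the open half plane reach its boundary through this lemma. *)
Lemma poly_Im_ge0_at0 (p : {poly R[i]}) :
  (forall t : R, 0 < t -> 0 <= imc p.[t%:C]) -> 0 <= imc p.[0].
Proof.
pose q : {poly R} := \poly_(k < size p) imc p`_k.
have qE t : q.[t] = imc p.[t%:C].
  rewrite horner_poly horner_coef Imc_sum; apply: eq_bigr => k _.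
  by rewrite -rmorphXn /= [in RHS]mulrC ImcZ mulrC.
by move=> H; have := qE 0; rewrite rmorph0 => <-; apply: poly_ge0_at0 => t /H; rewrite -qE.
Qed.

(** Serves to exclude poles of order [m >= 2]. The witness is the principal root of [i] or [- i],
    which cannot be real because its power is not. *)
Lemma rootC_Im_sign m (b : bool) : (1 < m)%N ->
  exists2 w : R[i], 0 < imc w & imc (w ^+ m) = (-1) ^+ b.
Proof.
move=> m1; pose c : R[i] := 0 +i* ((-1) ^+ b).
exists (m.-root c); last by rewrite rootCK // (ltn_trans _ m1).
have := @Im_rootC_ge0 _ m c m1; rewrite -complexIm ler0c le_eqVlt => /orP[/eqP w0|//].
have : imc c = 0.
  rewrite -[c](rootCK (ltnW m1)); case: (m.-root c) w0 => a d /= <-.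
  by rewrite -[a +i* 0]/(a%:C) -rmorphXn.
by move=> /eqP; rewrite /= signr_eq0.
Qed.

End ComplexFacts.

(** * Real-rooted polynomials *)

Section RealRooted.
Variable R : rcfType.
Local Open Scope complex_scope.
Notation toC := (real_complex R).
Notation CP := (map_poly toC).
Implicit Types (F G : {poly R}) (z w : R[i]).

Lemma horner_map_conjc (q : {poly R[i]}) (t : R) :
  (map_poly conjc q).[t%:C] = cj (q.[t%:C]).
Proof. by rewrite -[t%:C in LHS]conjc_real horner_map. Qed.

(** The roots of a real polynomial are closed under conjugation, so having none in the upper half
    plane leaves only real ones. *)
Lemma real_rooted_factor F : F != 0 ->
  (forall z, 0 < imc z -> (CP F).[z] != 0) ->
  exists l : 'I_(size F).-1 -> R, F = lead_coef F *: \prod_i ('X - (l i)%:P).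
Proof.
move=> F0 HF; have [rs Ers] := closed_field_poly_normal (CP F).
have F0' : CP F != 0 by rewrite map_poly_eq0.
have lF : lead_coef F != 0 by rewrite lead_coef_eq0.
have root_real z : z \in rs -> z = (rec z)%:C.
  move=> zrs; have rz : root (CP F) z.
    by rewrite Ers rootZ ?lead_coef_eq0 // root_prod_XsubC.
  have z0 : imc z <= 0 by rewrite leNgt; apply/negP => /HF; rewrite -rootE rz.
  have zJ0 : imc (cj z) <= 0.
    rewrite leNgt; apply/negP => /HF; apply/negP/negPn.
    have -> : CP F = map_poly conjc (CP F).
      by rewrite -map_poly_comp; apply: eq_map_poly => x /=; rewrite oppr0.
    by rewrite horner_map conjc_eq0 -rootE.
  have z1 : imc z = 0 by apply: le_anti; rewrite z0 -oppr_le0 -ImcJ zJ0.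
  by case: z z1 {zrs rz z0 zJ0} => a b /= ->.
have EF : F = lead_coef F *: \prod_(a <- map (fun z => rec z) rs) ('X - a%:P).
  apply: (map_poly_inj toC); rewrite Ers lead_coef_map map_polyZ rmorph_prod big_map /=.
  congr (_ *: _); apply: eq_big_seq => z /root_real Ez.
  by rewrite rmorphB /= map_polyX map_polyC /= -Ez.
have sz : size (map (fun z => rec z) rs) = (size F).-1.
  by rewrite EF size_scale // size_prod_XsubC.
exists (fun i => nth 0 (map (fun z => rec z) rs) i).
by rewrite {1}EF; congr (_ *: _); rewrite [LHS](big_nth 0) big_mkord sz.
Qed.

(** Approach [a] along [a + w t] with [t > 0]. After division by [t ^ m] the sign condition is
    polynomial in [t], so it passes to [t = 0], where [G] and [F2] take real values. *)
Lemma pole_sign G F2 (a : R) m w :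
  (forall z, 0 < imc z ->
     imc ((CP G).[z] * cj ((CP F2).[z] * (z - a%:C) ^+ m)) <= 0) ->
  0 < imc w -> 0 <= G.[a] * F2.[a] * imc (w ^+ m).
Proof.
move=> H w0; pose L : {poly R[i]} := (a%:C)%:P + w *: 'X.
have LE t : L.[t] = a%:C + w * t by rewrite !hornerE.
pose p := (CP G \Po L) * map_poly conjc (CP F2 \Po L) * (cj (w ^+ m))%:P.
have pE (t : R) : p.[t%:C] =
    (CP G).[a%:C + w * t%:C] * cj (CP F2).[a%:C + w * t%:C] * cj (w ^+ m).
  by rewrite !hornerE horner_map_conjc !horner_comp LE.
have : 0 <= imc (- p).[0].
  apply: poly_Im_ge0_at0 => t t0; rewrite hornerN ImcN oppr_ge0 pE.
  set z := a%:C + w * t%:C.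
  have z0 : 0 < imc z by rewrite ImcD mulrC ImcZ /= add0r mulr_gt0.
  have := H z z0; have -> : z - a%:C = w * t%:C by rewrite /z addrAC subrr add0r.
  set X := (CP G).[_]; set Y := (CP F2).[_].
  have -> : X * cj (Y * (w * t%:C) ^+ m) = (t ^+ m)%:C * (X * cj Y * cj (w ^+ m)).
    rewrite exprMn !conjcM (_ : t%:C ^+ m = (t ^+ m)%:C) ?conjc_real ?rmorphXn //.
    by ring.
  by rewrite ImcZ pmulr_rle0 // exprn_gt0.
have := pE 0; rewrite rmorph0 mulr0 addr0 hornerN ImcN => ->.
rewrite !horner_map conjc_real -mulrA !ImcZ ImcJ !mulrN opprK => H0.
by rewrite -mulrA.
Qed.

(* After cancelling common roots, the sign condition forces the poles of [G / F]
   to be simple with nonnegative residues. *)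
Lemma partial_fraction (I : finType) (l : I -> R) (A : {set I}) G :
  (size G <= #|A|)%N ->
  (forall z, 0 < imc z ->
     imc ((CP G).[z] * cj ((CP (\prod_(i in A) ('X - (l i)%:P))).[z])) <= 0) ->
  exists2 mu : I -> R, (forall i, 0 <= mu i) &
    G = \sum_(i in A) mu i *: \prod_(j in A :\ i) ('X - (l j)%:P).
Proof.
have [n] := ubnP #|A|; elim: n => // n IH in A G *; rewrite ltnS => An sG HG.
pose F (B : {set I}) := \prod_(i in B) ('X - (l i)%:P).
have FD1 (B : {set I}) i : i \in B -> F B = ('X - (l i)%:P) * F (B :\ i).
  by move=> iB; rewrite /F (big_setD1 i).
have Fm B : F B \is monic by apply: monic_prod => i _; apply: monicXsubC.
(* A common root is divided out of both polynomials and gets the residue 0. *)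
case: (pickP (fun i => (i \in A) && root G (l i))) => [i /andP[iA]|noroot].
  move=> /factor_theorem[G1 EG].
  have [] := IH (A :\ i) G1.
  - by rewrite (cardsD1 i) iA in An.
  - have [->|G10] := eqVneq G1 0; first by rewrite size_poly0.
    move: sG; rewrite EG size_Mmonic ?monicXsubC // size_XsubC addn2 /=.
    by rewrite (cardsD1 i) iA.
  - move=> z z0; have := HG z z0; rewrite -/(F A) (FD1 A i iA) EG !rmorphM !hornerM.
    rewrite rmorphB /= map_polyX map_polyC /= hornerXsubC.
    set X := (CP G1).[z]; set Y := (CP _).[z].
    have -> : X * (z - (l i)%:C) * cj ((z - (l i)%:C) * Y) =
       (normc2 (z - (l i)%:C))%:C * (X * cj Y).
      by rewrite -mulcJ rmorphM /=; ring.
    rewrite ImcZ pmulr_rle0 // normc2_gt0 subr_eq0; apply/eqP => zl.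
    by rewrite zl /= ltxx in z0.
  move=> mu mu0 EG1; exists (fun j => if j == i then 0 else mu j).
    by move=> j; case: ifP.
  rewrite (big_setD1 i) //= eqxx scale0r add0r EG EG1 mulr_suml.
  apply: eq_bigr => j /setD1P[ji jA]; rewrite (negbTE ji) -scalerAl; congr (_ *: _).
  rewrite -!/(F _) [in RHS](FD1 _ i) ?inE 1?eq_sym ?ji // mulrC; congr (_ * F _).
  by apply/setP => k; rewrite !inE; case: (k == i); case: (k == j).
have key i : i \in A -> (F (A :\ i)).[l i] != 0 /\ 0 <= G.[l i] * (F (A :\ i)).[l i].
  move=> iA; have [m [F2]] := multiplicity_XsubC (F A) (l i).
  rewrite monic_neq0 //= => nr EF.
  have Gi : G.[l i] != 0 by have := noroot i; rewrite iA /= rootE => ->.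
  have sgn w := @pole_sign G F2 (l i) m w.
  have {}sgn w : 0 < imc w -> 0 <= G.[l i] * F2.[l i] * imc (w ^+ m).
    apply: sgn => z z0; have := HG z z0; rewrite -/(F A) EF.
    rewrite rmorphM rmorphXn rmorphB /= map_polyX map_polyC /=.
    by rewrite hornerM horner_exp hornerXsubC.
  have rF : root (F A) (l i) by rewrite (FD1 _ _ iA) rootM root_XsubC eqxx.
  case: m => [|[|m]] in EF sgn *.
  - by move: rF; rewrite EF expr0 mulr1 (negbTE nr).
  - have E2 : F2 = F (A :\ i).
      apply: (@mulIf _ ('X - (l i)%:P)); first by rewrite polyXsubC_eq0.
      by rewrite -[RHS]mulrC -FD1 // EF expr1.
    rewrite -E2; split; first by rewrite -rootE.
    by have := sgn 'i%C; rewrite expr1 /= mulr1; apply; rewrite ltr01.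
  (* A pole of order at least 2 would force both signs on [G.[l i] * F2.[l i]], hence the value 0,
     while neither factor vanishes. *)
  - have [w1 w10 E1] := @rootC_Im_sign R m.+2 false isT.
    have [w2 w20 E2] := @rootC_Im_sign R m.+2 true isT.
    have := sgn _ w10; have := sgn _ w20; rewrite E1 E2 expr0 expr1 mulr1 mulrN1 oppr_ge0.
    move=> h1 h2; have : G.[l i] * F2.[l i] == 0 by rewrite eq_le h1 h2.
    by rewrite mulf_eq0 (negbTE Gi) /=; move: nr; rewrite rootE => /negbTE ->.
pose mu i := if i \in A then G.[l i] / (F (A :\ i)).[l i] else 0.
exists mu.
  move=> i; rewrite /mu; case: ifP => // /key[n0 s0].
  have -> : G.[l i] / (F (A :\ i)).[l i] =
     G.[l i] * (F (A :\ i)).[l i] / (F (A :\ i)).[l i] ^+ 2 by field.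
  by rewrite divr_ge0 ?sqr_ge0.
(* Both sides have degree below [#|A|] and agree at the points [l i], which are distinct by
   [key]. *)
apply/eqP; rewrite -subr_eq0; apply/eqP.
apply: (@roots_geq_poly_eq0 _ _ [seq l i | i <- enum A]).
- rewrite all_map; apply/allP => i; rewrite mem_enum => iA.
  rewrite /= rootE hornerD hornerN horner_sum (bigD1 i) //=.
  rewrite [X in _ - (_ + X)]big1 ?addr0 => [|j /andP[jA ji]].
    by rewrite hornerZ /mu iA divfK ?subrr //; case: (key i iA).
  rewrite hornerZ -/(F _) (FD1 _ i) ?inE 1?eq_sym ?ji //.
  by rewrite hornerM hornerXsubC subrr mul0r mulr0.
- rewrite map_inj_in_uniq ?enum_uniq // => i j; rewrite !mem_enum => iA jA Eij.
  apply/eqP; apply: contraT => ij; have [+ _] := key i iA.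
  by rewrite (FD1 _ j) ?inE 1?eq_sym ?ij // hornerM hornerXsubC Eij subrr mul0r eqxx.
- rewrite size_map -cardE; apply: leq_trans (size_polyD _ _) _.
  rewrite geq_max sG size_polyN; apply: leq_trans (size_sum _ _ _) _.
  apply/bigmax_leqP => i iA; apply: leq_trans (size_scale_leq _ _) _.
  rewrite -big_enum size_prod_XsubC -cardE.
  by rewrite [X in (_ <= X)%N](cardsD1 i) iA.
Qed.

End RealRooted.

(** * Multi-affine polynomials *)

Section MultiAffine.
Variables (V : finType) (R : comNzRingType).
Implicit Types (c : {set V} -> R) (S T U W : {set V}) (u v : V).

(* A multi-affine polynomial is given by its coefficients: [ev f c z] is its value
   at [z], and [pd U c] is its derivative in all the variables of [U]. *)
Definition ev (K : comNzRingType) (f : R -> K) c (z : V -> K) : K :=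
  \sum_(S : {set V}) f (c S) * \prod_(i in S) z i.

Definition pd U c : {set V} -> R :=
  fun S => if [disjoint U & S] then c (U :|: S) else 0.

Lemma pd0 c : pd set0 c = c.
Proof.
by apply: funext => S; rewrite /pd set0U -setI_eq0 set0I eqxx.
Qed.

Lemma pd_comm U W c : pd U (pd W c) = pd W (pd U c).
Proof.
apply: funext => S; rewrite /pd -!setI_eq0 !setIUr !setU_eq0.
rewrite !setUA [W :|: U]setUC [W :&: U]setIC.
by do 3!case: (_ == set0 :> {set V}).
Qed.

Lemma pd_pd U W c : [disjoint U & W] -> pd U (pd W c) = pd (U :|: W) c.
Proof.
rewrite -setI_eq0 => /eqP d; apply: funext => S; rewrite /pd -!setI_eq0 setIUr setIUl !setU_eq0.
by rewrite [W :&: U]setIC d eqxx /= !setUA [W :|: U]setUC; do 2!case: (_ == set0 :> {set V}).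
Qed.

(** A common variable is differentiated twice, and the polynomial has degree at most one in it. *)
Lemma pd_meet U W c : ~~ [disjoint U & W] -> pd U (pd W c) = fun=> 0.
Proof.
rewrite -setI_eq0 => d; apply: funext => S; rewrite /pd -!setI_eq0 setIUr setU_eq0.
by rewrite [W :&: U]setIC (negbTE d); case: ifP.
Qed.

Section Eval.
Variables (K : comNzRingType) (f : {rmorphism R -> K}).
Implicit Types z y : V -> K.

Lemma ev_const0 z : ev f (fun=> 0) z = 0.
Proof. by rewrite /ev big1 // => S _; rewrite rmorph0 mul0r. Qed.

Lemma prod_addE T y z :
  \prod_(i in T) (z i + y i) =
  \sum_(U : {set V} | U \subset T) (\prod_(i in T :\: U) z i) * \prod_(i in U) y i.
Proof.
rewrite big_mkcond /=.
transitivity (\prod_i ((if i \in T then y i else 0) + (if i \in T then z i else 1))).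
  by apply: eq_bigr => i _; case: ifP; rewrite ?add0r // addrC.
rewrite bigA_distr [RHS]big_mkcond /=; apply: eq_bigr => U _.
case: (boolP (U \subset T)) => [UT|/subsetPn[i iU iT]]; last first.
  by rewrite (bigD1 i) //= iU (negbTE iT) mul0r.
rewrite (bigID (mem U)) /= mulrC; congr (_ * _).
  rewrite big_mkcond [RHS]big_mkcond; apply: eq_bigr => i _; rewrite !inE.
  by case: (i \in U).
by apply: eq_bigr => i iU; rewrite iU (subsetP UT).
Qed.

Lemma ev_taylor c z y :
  ev f c (fun i => z i + y i) =
  \sum_(U : {set V}) ev f (pd U c) z * \prod_(i in U) y i.
Proof.
rewrite /ev; under eq_bigr => S _ do rewrite prod_addE mulr_sumr.
rewrite (exchange_big_dep predT) //=; apply: eq_bigr => U _.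
rewrite mulr_suml [RHS](bigID (fun S => [disjoint U & S])) /= [X in _ = _ + X]big1 ?addr0.
  rewrite [RHS](reindex_onto (fun T => T :\: U) (fun S => U :|: S)) /=; last first.
    move=> S; rewrite -setI_eq0 => /eqP d; apply/setP => i; move/setP: d => /(_ i).
    by rewrite !inE; case: (i \in U).
  have UD S : U :|: (S :\: U) = U :|: S by apply/setP=> i; rewrite !inE; case: (i \in U).
  apply: eq_big => S.
    have dU : U :&: (S :\: U) = set0.
      by apply/setP=> i; rewrite !inE; case: (i \in U); rewrite ?andbF.
    apply/idP/andP => [/setUidPr US|[_ /eqP <-]]; last by rewrite subsetUl.
    by rewrite -setI_eq0 dU eqxx UD US eqxx.
  move=> US; rewrite /pd -setI_eq0.
  have -> : U :&: (S :\: U) = set0 by apply/setP=> i; rewrite !inE; case: (i \in U); rewrite ?andbF.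
  by rewrite eqxx UD (setUidPr US) mulrA.
by move=> S d; rewrite /pd (negbTE d) rmorph0 !mul0r.
Qed.

Lemma ev_shift c z v t :
  ev f c (fun i => z i + t *+ (i == v)) = ev f c z + t * ev f (pd [set v] c) z.
Proof.
rewrite ev_taylor (bigD1 set0) //= big_set0 mulr1 pd0; congr (_ + _).
rewrite (bigD1 [set v]) /=; last by rewrite -cards_eq0 cards1.
rewrite big_set1 eqxx mulr1n mulrC big1 ?addr0 // => U /andP[U0 Uv].
have /subsetPn[i iU] : ~~ (U \subset [set v]) by rewrite subset1 negb_or Uv.
by rewrite inE => iv; rewrite (bigD1 i) //= (negbTE iv) mulr0n mul0r mulr0.
Qed.

Lemma ev_pd_ext U c z y : (forall i, i \notin U -> z i = y i) ->
  ev f (pd U c) z = ev f (pd U c) y.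
Proof.
move=> zy; apply: eq_bigr => S _; rewrite /pd; case: ifP => [d|_]; last by rewrite rmorph0 !mul0r.
congr (_ * _); apply: eq_bigr => i iS; apply: zy; apply/negP => iU.
by move: d; rewrite -setI_eq0 => /eqP/setP/(_ i); rewrite !inE iU iS.
Qed.

Lemma ev_sum I (r : seq I) (P : pred I) (C : I -> {set V} -> R) z :
  ev f (fun S => \sum_(k <- r | P k) C k S) z = \sum_(k <- r | P k) ev f (C k) z.
Proof.
rewrite /ev exchange_big /=; apply: eq_bigr => S _.
by rewrite rmorph_sum mulr_suml.
Qed.

End Eval.

Lemma pd_sum I (r : seq I) (P : pred I) (C : I -> {set V} -> R) U :
  pd U (fun S => \sum_(k <- r | P k) C k S) = fun S => \sum_(k <- r | P k) pd U (C k) S.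
Proof.
by apply: funext => S; rewrite /pd; case: ifP => // _; rewrite big1.
Qed.

Lemma ev_morph (K L : comNzRingType) (f : R -> K) (g : {rmorphism K -> L}) c z :
  g (ev f c z) = ev (g \o f) c (g \o z).
Proof.
rewrite /ev rmorph_sum; apply: eq_bigr => S _.
by rewrite rmorphM rmorph_prod.
Qed.

End MultiAffine.

(** * Stability *)

Section Stable.
Variables (V : finType) (R : rcfType).
Local Open Scope complex_scope.
Notation toC := (real_complex R).
Notation evR := (ev idfun).
Notation evC := (ev toC).
Implicit Types (c : {set V} -> R) (A S T U W : {set V}) (u v k : V) (z : V -> R[i]).

Lemma evC_real c (x : V -> R) : evC c (fun v => (x v)%:C) = (evR c x)%:C.
Proof. exact/esym/(ev_morph idfun toC). Qed.

Definition upper z := forall v, 0 < imc (z v).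

(* Asking nonvanishing of the derivatives as well spares a Hurwitz limit argument. *)
Definition stable W c :=
  forall U, U \subset W -> forall z, upper z -> evC (pd U c) z != 0.

Lemma stable_pd W U c : stable W c -> U \subset W -> stable (W :\: U) (pd U c).
Proof.
move=> st UW U'; rewrite subsetD => /andP[U'W d] z z0.
by rewrite pd_pd //; apply: st => //; rewrite subUset U'W.
Qed.

(** Division-free form of the statement that [c] over its derivative in [v] has imaginary part at
    least [imc (z v)]. In this form it survives the passage to the boundary. *)
Lemma stable_Im W c v z : stable W c -> v \in W -> upper z ->
  imc (z v) * normc2 (evC (pd [set v] c) z) <=
    imc (evC c z * cj (evC (pd [set v] c) z)).
Proof.
move=> st vW z0; set a := evC c z; set b := evC _ z.
have b0 : b != 0 by apply: st; rewrite ?sub1set.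
(* [c] vanishes once [z v] is moved to [z v - a / b], which therefore lies outside
   the upper half plane. *)
rewrite -ler_pdivlMr ?normc2_gt0 // -Imc_div // leNgt; apply/negP => lt_ab.
have : evC c (fun i => z i + (- (a / b)) *+ (i == v)) != 0.
  rewrite -[c in evC c]pd0; apply: st; first exact: sub0set.
  move=> i; have [->|_] := eqVneq i v; last by rewrite addr0.
  by rewrite mulr1n ImcB subr_gt0.
by rewrite ev_shift -/a -/b mulNr divfK // subrr eqxx.
Qed.

Lemma horner_ev (c : {set V} -> R) (Z : V -> {poly R[i]}) t :
  (ev (polyC \o toC) c Z).[t] = evC c (fun v => (Z v).[t]).
Proof.
rewrite /ev horner_sum; apply: eq_bigr => S _.
by rewrite hornerM horner_prod hornerC.
Qed.

(** Move every variable up by [i t] with [t > 0], apply [stable_Im], and let [t] tend to 0 in the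
    resulting polynomial. *)
Lemma stable_Im_closed W c v z : stable W c -> v \in W ->
  (forall i, 0 <= imc (z i)) ->
  imc (z v) * normc2 (evC (pd [set v] c) z) <=
    imc (evC c z * cj (evC (pd [set v] c) z)).
Proof.
move=> st vW z0; rewrite -subr_ge0.
pose Z i : {poly R[i]} := (z i)%:P + 'i%C *: 'X.
have ZE i t : (Z i).[t] = z i + 'i%C * t by rewrite !hornerE.
pose a := ev (polyC \o toC) c Z; pose b := ev (polyC \o toC) (pd [set v] c) Z.
pose p := a * map_poly conjc b -
  'i%C%:P * (((imc (z v))%:C)%:P + 'X) * (b * map_poly conjc b).
have pE (t : R) : imc p.[t%:C] =
    imc (evC c (fun i => (Z i).[t%:C]) *
         cj (evC (pd [set v] c) (fun i => (Z i).[t%:C]))) -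
    (imc (z v) + t) * normc2 (evC (pd [set v] c) (fun i => (Z i).[t%:C])).
  rewrite hornerD hornerN !hornerM horner_map_conjc !horner_ev ImcB mulcJ; congr (_ - _).
  have key (r s : R) : imc ('i%C * r%:C * s%:C) = r * s by rewrite /=; ring.
  by rewrite hornerC hornerD hornerC hornerX -key (rmorphD toC (imc (z v)) t).
have : 0 <= imc p.[0].
  apply: poly_Im_ge0_at0 => t t0; rewrite pE subr_ge0.
  have Zim i : imc (Z i).[t%:C] = imc (z i) + t.
    by rewrite ZE ImcD /= mul0r mul1r add0r.
  rewrite -Zim; apply: (stable_Im st vW) => i.
  by rewrite Zim ltr_wpDl.
have := pE 0; rewrite rmorph0 addr0 => ->.
rewrite (_ : (fun i => (Z i).[0]) = z) //.
by apply: funext => i; rewrite ZE mulr0 addr0.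
Qed.

(** Keep all variables real except [u], which is moved up by [i]: the imaginary part in
    [stable_Im_closed] is then exactly the difference of the two sides. *)
Lemma rayleigh W c u v (x : V -> R) : stable W c -> v \in W -> u != v ->
  evR c x * evR (pd [set v] (pd [set u] c)) x <=
  evR (pd [set u] c) x * evR (pd [set v] c) x.
Proof.
move=> st vW uv.
pose z i : R[i] := (x i)%:C + 'i%C *+ (i == u).
have := @stable_Im_closed W c v z st vW.
have -> : imc (z v) = 0 by rewrite /z eq_sym (negbTE uv) addr0.
rewrite mul0r /z !ev_shift !evC_real pd_comm /= => H.
have {}H := H _; rewrite -subr_ge0; apply: le_trans (H _) _.
  by move=> i; case: (i == u); rewrite /= ?addr0 ?add0r ?ler01.
by rewrite le_eqVlt; apply/orP; left; apply/eqP => /=; ring.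
Qed.

Lemma pd1_setD1 A k c : k \in A -> pd [set k] (pd (A :\ k) c) = pd A c.
Proof.
by move=> kA; rewrite pd_pd ?setD1K // disjoints1 !inE eqxx.
Qed.

(** When [A] is the row of an index, the term of [k] corresponds to giving that index the colour of
    [k]. Up to a factor this is the average over the colours. *)
Definition avg A c : {set V} -> R := fun S => \sum_(k in A) pd (A :\ k) c S.

Lemma pd_avg U A c : pd U (avg A c) = avg A (pd U c).
Proof.
rewrite /avg pd_sum; apply: funext => S; apply: eq_bigr => k _.
by rewrite pd_comm.
Qed.

(** Divided by [pd A c], each term has positive imaginary part by [stable_Im] in the variable [k],
    and so has the sum. *)
Lemma stable_avg W A c : stable W c -> A \subset W -> A != set0 ->
  stable (W :\: A) (avg A c).
Proof.
move=> st AW /set0Pn[k0 k0A] U; rewrite subsetD => /andP[UW dUA] z z0.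
rewrite pd_avg; move: (pd U c) (stable_pd st UW) => {st}c st.
have AWU : A \subset W :\: U by rewrite subsetD AW disjoint_sym.
rewrite /avg ev_sum; set Q := evC (pd A c) z.
have Q0 : Q != 0 by apply: st.
apply/negP => /eqP E.
suff : 0 < imc ((\sum_(k in A) evC (pd (A :\ k) c) z) * cj Q).
  by rewrite E mul0r ltxx.
rewrite mulr_suml Imc_sum.
have pos k : k \in A -> 0 < imc (evC (pd (A :\ k) c) z * cj Q).
  move=> kA; have stk : stable ((W :\: U) :\: (A :\ k)) (pd (A :\ k) c).
    by apply: stable_pd => //; apply: subset_trans AWU; rewrite subsetDl.
  have := stable_Im (v := k) stk _ z0; rewrite pd1_setD1 // => H.
  apply: lt_le_trans (H _); first by rewrite mulr_gt0 ?normc2_gt0.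
  by rewrite !inE eqxx /=; have := subsetP AWU _ kA; rewrite inE.
rewrite (bigD1 k0) //= ltr_pwDl ?pos // sumr_ge0 // => k /andP[kA _].
exact/ltW/pos.
Qed.

Definition diag c : {poly R} := ev polyC c (fun=> 'X).

Lemma horner_diag c t : (diag c).[t] = evR c (fun=> t).
Proof.
rewrite /diag /ev horner_sum; apply: eq_bigr => S _.
by rewrite hornerM horner_prod hornerC; under eq_bigr => i _ do rewrite hornerX.
Qed.

Lemma horner_diagC c (z : R[i]) : (map_poly toC (diag c)).[z] = evC c (fun=> z).
Proof.
rewrite /diag (ev_morph polyC (map_poly toC)) /ev horner_sum; apply: eq_bigr => S _.
rewrite hornerM horner_prod /= map_polyC hornerC; congr (_ * _).
by apply: eq_bigr => i _; rewrite /= map_polyX hornerX.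
Qed.

(* Equality of the leading coefficients makes the quotients studied in
   [interlacing_remainder] asymptotic to the identity. *)
Definition leading W d l c := (#|W| <= d)%N /\
  forall U, U \subset W -> (size (diag (pd U c)) <= (d - #|U|).+1)%N /\
    (diag (pd U c))`_(d - #|U|) = l.

Lemma leading_pd W d l U c : leading W d l c -> U \subset W ->
  leading (W :\: U) (d - #|U|) l (pd U c).
Proof.
move=> [Wd H] UW; split.
  by rewrite cardsD (setIidPr UW) leq_sub2r.
move=> U'; rewrite subsetD => /andP[U'W dU].
rewrite pd_pd // -subnDA addnC -cardsUI disjoint_setI0 // cards0 addn0.
by apply: H; rewrite subUset U'W.
Qed.

Lemma diag_avg A c : diag (avg A c) = \sum_(k in A) diag (pd (A :\ k) c).
Proof. exact: ev_sum. Qed.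

(** Each of the [#|A|] terms has lost [#|A|.-1] in degree and keeps the coefficient [l], so no
    cancellation occurs. *)
Lemma leading_avg W d l A c : leading W d l c -> A \subset W -> A != set0 ->
  leading (W :\: A) (d - #|A|.-1) (l *+ #|A|) (avg A c).
Proof.
move=> [Wd H] AW A0; have cA : (0 < #|A|)%N by rewrite card_gt0.
have cAW := subset_leq_card AW.
split; first by rewrite cardsD (setIidPr AW); lia.
move=> U; rewrite subsetD => /andP[UW dU].
rewrite pd_avg diag_avg.
have key k : k \in A ->
  (size (diag (pd (A :\ k) (pd U c))) <= (d - #|A|.-1 - #|U|).+1)%N /\
  (diag (pd (A :\ k) (pd U c)))`_(d - #|A|.-1 - #|U|) = l.
  move=> kA; have dAk : [disjoint A :\ k & U].
    by rewrite disjoint_sym; apply: disjointWr dU; rewrite subsetDl.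
  rewrite pd_pd // -subnDA.
  have <- : #|A :\ k :|: U| = (#|A|.-1 + #|U|)%N.
    by rewrite (cardsD1 k A) kA -cardsUI disjoint_setI0 // cards0 addn0.
  by apply: H; rewrite subUset UW andbT; apply: subset_trans AW; rewrite subsetDl.
split.
  apply: leq_trans (size_sum _ _ _) _; apply/bigmax_leqP => k kA.
  by case: (key k kA).
rewrite coef_sum (eq_bigr (fun=> l)) ?sumr_const // => k kA.
by case: (key k kA).
Qed.

End Stable.

(** * Interlacing *)

Section Interlacing.
Variables (V : finType) (R : rcfType).
Local Open Scope complex_scope.
Notation toC := (real_complex R).
Notation evR := (ev idfun).
Notation evC := (ev toC).
Notation CP := (map_poly toC).
Implicit Types (c : {set V} -> R) (A W : {set V}) (k : V).

(** For a positive leading coefficient, this says that the largest real root on the diagonal lies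
    below [b]. *)
Definition positive_from b c := forall x : R, b <= x -> 0 < evR c (fun=> x).

(* [Q] is a common interlacer: above its largest root every [q / Q] is
   increasing, so the sign of [q] at one point decides its sign beyond. *)
Lemma interlacing_remainder (q Q : {poly R}) m l :
  0 < l -> size Q = m.+1 -> lead_coef Q = l ->
  (size q <= m.+2)%N -> q`_m.+1 = l ->
  (forall z, 0 < imc z -> imc z * normc2 (CP Q).[z] <= imc ((CP q).[z] * cj (CP Q).[z])) ->
  forall la : 'I_m -> R, Q = l *: \prod_i ('X - (la i)%:P) ->
  exists h, exists2 mu : 'I_m -> R, (forall i, 0 <= mu i) &
    q = ('X + h%:P) * Q -
        l *: \sum_i mu i *: \prod_(j in [set: 'I_m] :\ i) ('X - (la j)%:P).
Proof.
move=> l0 sQ lQ sq lq HI la EQ.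
have Qm : Q`_m = l by rewrite -lQ lead_coefE sQ.
(* ['X + h] is the polynomial part of [q / Q]: with this [h] the coefficients of degree [m] and
   [m + 1] cancel in [G]. *)
pose h := (q`_m - ('X * Q)`_m) / l.
pose G := ('X + h%:P) * Q - q.
have sG : (size G <= m)%N.
  apply/leq_sizeP => j mj; rewrite coefB mulrDl coefD coefCM.
  move: mj; rewrite leq_eqVlt => /orP[/eqP <-|].
    by rewrite Qm /h divfK ?gt_eqF //; ring.
  case: j => // j; rewrite ltnS coefXM /= => mj.
  rewrite [Q`_j.+1]nth_default ?sQ // mulr0 addr0.
  move: mj; rewrite leq_eqVlt => /orP[/eqP <-|mj]; first by rewrite Qm lq subrr.
  by rewrite !nth_default ?subrr ?sQ // (leq_trans sq).
have l0' : l != 0 by rewrite gt_eqF.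
have [|z z0|mu mu0 EG] := @partial_fraction _ _ la [set: 'I_m] (l^-1 *: G).
- by rewrite cardsT card_ord (leq_trans (size_scale_leq _ _)).
- set F := \prod_(i in _) _.
  have EF : Q = l *: F by rewrite EQ; congr (_ *: _); apply: eq_bigl => i; rewrite inE.
  (* Divided by the squared modulus of [Q], this reads [imc z - imc (q / Q) <= 0]. *)
  have : imc ((CP G).[z] * cj (CP Q).[z]) <= 0.
    have CG : CP G = ('X + (h%:C)%:P) * CP Q - CP q.
      by rewrite rmorphB rmorphM rmorphD /= map_polyX map_polyC.
    have := HI z z0; rewrite CG hornerD hornerN !hornerM hornerD hornerX hornerC.
    set a := (CP q).[z]; set b := (CP Q).[z] => H.
    have -> : ((z + h%:C) * b - a) * cj b = (normc2 b)%:C * (z + h%:C) - a * cj b.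
      by rewrite -mulcJ; ring.
    by rewrite ImcB ImcZ ImcD addr0 mulrC subr_le0.
  rewrite EF !map_polyZ !hornerZ /=.
  set a := (CP G).[z]; set b := (CP F).[z].
  have -> : a * cj (l%:C * b) = (l ^+ 2)%:C * (l^-1%:C * a * cj b).
    have E : (l ^+ 2)%:C * l^-1%:C = l%:C :> R[i].
      by rewrite -(rmorphM toC) expr2 mulfK.
    by rewrite conjcM conjc_real !mulrA E; ring.
  by rewrite ImcZ pmulr_rle0 ?exprn_gt0.
exists h, mu => //.
have -> : \sum_i mu i *: \prod_(j in [set: 'I_m] :\ i) ('X - (la j)%:P) = l^-1 *: G.
  by rewrite EG; apply: eq_bigl => i; rewrite inE.
by rewrite scalerA divff // scale1r /G; ring.
Qed.

(** The summands of the average share the interlacer [Q = diag (pd A c)]. One of them is positive at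
    [b], and then it stays positive. *)
Lemma interlacing W d l A c b : stable W c -> leading W d l c -> 0 < l ->
  A \subset W -> A != set0 -> positive_from b (avg A c) ->
  exists2 k, k \in A & positive_from b (pd (A :\ k) c).
Proof.
move=> st [Wd ld] l0 AW A0 pos; have cA : (0 < #|A|)%N by rewrite card_gt0.
have cAW := subset_leq_card AW.
pose Q := diag (pd A c); pose q k := diag (pd (A :\ k) c).
set m := (d - #|A|)%N in ld *.
have [sQ lQ] := ld A AW; rewrite -/Q -/m in sQ lQ.
have {}sQ : size Q = m.+1.
  apply/eqP; rewrite eqn_leq sQ ltnNge; apply/negP => /leq_sizeP/(_ m (leqnn _)).
  by rewrite lQ => E; rewrite E ltxx in l0.
have lcQ : lead_coef Q = l by rewrite lead_coefE sQ.
have Q0 : Q != 0 by rewrite -size_poly_gt0 sQ.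
have [] := @real_rooted_factor _ Q Q0.
  by move=> z z0; rewrite horner_diagC; apply: st.
rewrite lcQ sQ /= => la EQ.
have rem k : k \in A -> exists h, exists2 mu : 'I_m -> R, (forall i, 0 <= mu i) &
    q k = ('X + h%:P) * Q -
        l *: \sum_i mu i *: \prod_(j in [set: 'I_m] :\ i) ('X - (la j)%:P).
  move=> kA; have Ak : A :\ k \subset W by apply: subset_trans AW; rewrite subsetDl.
  have cAk : (d - #|A :\ k|)%N = m.+1.
    by rewrite /m; move: cA cAW Wd; rewrite (cardsD1 k A) kA; lia.
  have [sq lq] := ld _ Ak; rewrite cAk in sq lq.
  apply: interlacing_remainder => // z z0; rewrite !horner_diagC.
  have := @stable_Im _ _ (W :\: (A :\ k)) (pd (A :\ k) c) k (fun=> z).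
  rewrite pd1_setD1 //; apply=> //; first exact: stable_pd.
  by rewrite !inE eqxx /= (subsetP AW).
have posE x : b <= x -> 0 < \sum_(k in A) (q k).[x].
  move=> bx; have := pos x bx; rewrite ev_sum /=.
  by under eq_bigr => k _ do rewrite -horner_diag.
have horQ x : Q.[x] = l * \prod_i (x - la i).
  by rewrite EQ hornerZ horner_prod; under eq_bigr => i _ do rewrite hornerXsubC.
(* At the largest root of [Q] the formula in [rem] makes every [q k] nonpositive, so this root
   cannot lie where the sum is positive. *)
have la_lt i : la i < b.
  rewrite ltNge; apply/negP => bi.
  have [i0 _ i0max] := Order.TotalTheory.arg_maxP la (erefl : xpredT i).
  have bi0 : b <= la i0 by apply: le_trans bi (i0max _ _).
  have := posE _ bi0; apply/negP; rewrite -leNgt; apply: sumr_le0 => k kA.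
  have [h [mu mu0 ->]] := rem k kA.
  have Q0' : Q.[la i0] = 0.
    by rewrite horQ (bigD1 i0) //= subrr mul0r mulr0.
  rewrite hornerD hornerM Q0' mulr0 add0r hornerN oppr_le0 hornerZ horner_sum.
  rewrite mulr_ge0 ?(ltW l0) // sumr_ge0 // => j _.
  rewrite hornerZ mulr_ge0 // horner_prod prodr_ge0 // => j' _.
  by rewrite hornerXsubC subr_ge0; exact: i0max.
have Qpos x : b <= x -> 0 < Q.[x].
  move=> bx; rewrite horQ mulr_gt0 // prodr_gt0 // => i _.
  by rewrite subr_gt0 (lt_le_trans (la_lt i)).
have [k kA qk] : exists2 k, k \in A & 0 < (q k).[b].
  case: (pickP (fun k => (k \in A) && (0 < (q k).[b]))) => [k /andP[? ?]|none].
    by exists k.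
  have := posE b (lexx b); rewrite ltNge sumr_le0 // => k kA.
  by have := none k; rewrite kA /= ltNge => /negbFE.
exists k => // x bx; rewrite -horner_diag -/(q k).
have [h [mu mu0 E]] := rem k kA.
(* Beyond [b], [Q] is positive and the second factor increases with [y], so positivity at [b]
   persists. *)
have qE y : b <= y -> (q k).[y] = Q.[y] * (y + h - \sum_i mu i / (y - la i)).
  move=> yb; have ne i : y - la i != 0 by rewrite subr_eq0 gt_eqF // (lt_le_trans (la_lt i)).
  rewrite E hornerD hornerM hornerD hornerX hornerC mulrBr mulrC; congr (_ + _).
  rewrite hornerN hornerZ horner_sum horQ -mulrA; congr (- _); congr (_ * _).
  rewrite mulr_sumr.
  apply: eq_bigr => i _; rewrite hornerZ horner_prod [in RHS](bigD1 i) //=.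
  have dE (a e p : R) : e != 0 -> e * p * (a / e) = a * p by move=> e0; field.
  rewrite dE //; congr (_ * _).
  by apply: eq_big => j; rewrite ?inE ?andbT // hornerXsubC.
rewrite qE // pmulr_rgt0 ?Qpos //.
move: qk; rewrite qE // pmulr_rgt0 ?Qpos // => /lt_le_trans; apply.
apply: lerB; first by rewrite lerD2r.
apply: ler_sum => i _; rewrite ler_wpM2l // lef_pV2 ?posrE ?subr_gt0 //.
  by rewrite lerD2r.
exact: lt_le_trans (la_lt i) bx.
Qed.

End Interlacing.

(** * The barrier argument *)

Section BarrierStep.
Variable R : rcfType.
Local Open Scope complex_scope.
Notation CP := (map_poly (real_complex R)).

Lemma coef0_prod_XaddC (I : finType) (a : I -> R) (A : {set I}) :
  (\prod_(i in A) ('X - (- a i)%:P))`_0 = \prod_(i in A) a i.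
Proof.
rewrite -horner_coef0 horner_prod; apply: eq_bigr => i _.
by rewrite hornerXsubC sub0r opprK.
Qed.

Lemma coef1_prod_XaddC m (a : 'I_m -> R) : (forall i, a i != 0) ->
  (\prod_i ('X - (- a i)%:P))`_1 = \prod_i a i * \sum_i (a i)^-1.
Proof.
move=> a0; pose K (p : {poly R}) (b s : R) := p`_0 = b /\ p`_1 = b * s.
suff [] : K (\prod_i ('X - (- a i)%:P)) (\prod_i a i) (\sum_i (a i)^-1) by [].
elim/big_rec3: _ => [|i s b p _ [Ep0 Ep1]]; first by split; rewrite coef1 // mulr0.
rewrite polyCN opprK; split; rewrite mulrDl coefD coefXM coefCM /= ?add0r ?Ep0 ?Ep1 //.
by have ai := a0 i; field.
Qed.

Lemma coefPn_prod_XaddC m (a : 'I_m.+1 -> R) :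
  (\prod_i ('X - (- a i)%:P))`_m = \sum_i a i.
Proof.
have := @coefPn_prod_XsubC _ [seq - a i | i <- index_enum (ordinal m.+1)].
have sE : size (index_enum (ordinal m.+1)) = m.+1 by rewrite -[RHS]card_ord cardT enumT.
by rewrite size_map sE !big_map => -> //=; rewrite sumrN opprK.
Qed.

(* Writing [f = Q * \prod (X + a_i)] and [w / f = omega + \sum mu_i / (X + a_i)],
   the claim follows from [\sum_j a_j - s (r - 2) >= a_i], which holds for every
   [i] because [a_j >= 2 s - s^2 / a_j]. *)
Lemma row_inequality (f w : {poly R}) r s : (0 < r)%N -> 0 < s ->
  size f = r.+1 -> 0 < f`_r -> (size w <= r.+1)%N ->
  (forall t, 0 <= t -> 0 < f.[t]) ->
  (forall z, 0 < imc z -> (CP f).[z] != 0) ->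
  (forall z, 0 < imc z -> imc ((CP w).[z] * cj (CP f).[z]) <= 0) ->
  s * w`_0 <= f`_0 -> s * f`_1 <= r%:R * f`_0 ->
  s * (r%:R - 2) * (f`_r - s * w`_r) <= f`_r.-1 - s * w`_r.-1.
Proof.
case: r => // r _ s0 sf Q0 sw fpos fnz wf_im sw0 sf1.
have f0 : f != 0 by rewrite -size_poly_gt0 sf.
have lf : lead_coef f = f`_r.+1 by rewrite lead_coefE sf.
have [] := real_rooted_factor f0 fnz; rewrite sf lf /= => la Ef.
pose a i := - la i; set Q := f`_r.+1 in Q0 lf Ef *.
have {}Ef : f = Q *: \prod_i ('X - (- a i)%:P).
  by rewrite Ef; congr (_ *: _); apply: eq_bigr => i _; rewrite opprK.
have Qn : Q != 0 by rewrite gt_eqF.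
have a0 i : 0 < a i.
  rewrite ltNge; apply/negP => ai; have := fpos (- a i); rewrite oppr_ge0 => /(_ ai).
  by rewrite Ef hornerZ horner_prod (bigD1 i) //= hornerXsubC subrr mul0r mulr0 ltxx.
have an i : a i != 0 by rewrite gt_eqF.
pose om := w`_r.+1 / Q; pose G := w - om *: f.
have sG : (size G <= r.+1)%N.
  apply/leq_sizeP => j; rewrite leq_eqVlt => /orP[/eqP <-|rj].
    by rewrite coefB coefZ -/Q divfK // subrr.
  by rewrite coefB coefZ !nth_default ?sf ?mulr0 ?subrr // (leq_trans sw).
pose F := \prod_i ('X - (- a i)%:P).
have EF : \prod_(i in [set: 'I_r.+1]) ('X - (- a i)%:P) = F.
  by apply: eq_bigl => i; rewrite inE.
have [|z z0|mu mu0] := @partial_fraction _ _ (fun i => - a i) [set: 'I_r.+1] (Q^-1 *: G).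
- by rewrite cardsT card_ord (leq_trans (size_scale_leq _ _)).
- rewrite EF; have := wf_im z z0.
  have -> : CP w = CP G + om%:C *: CP f.
    by rewrite /G rmorphB /= map_polyZ subrK.
  rewrite hornerD hornerZ mulrDl ImcD -mulrA mulcJ -rmorphM /= addr0.
  rewrite Ef -/F !map_polyZ !hornerZ /=; set x := (CP G).[z]; set y := (CP F).[z].
  have -> : x * cj (Q%:C * y) = (Q ^+ 2)%:C * (Q^-1%:C * x * cj y).
    have E : (Q ^+ 2)%:C * Q^-1%:C = Q%:C :> R[i].
      by rewrite -(rmorphM (real_complex R)) expr2 mulfK.
    by rewrite conjcM conjc_real !mulrA E; ring.
  by rewrite ImcZ pmulr_rle0 ?exprn_gt0.
rewrite (eq_bigl xpredT) => [EG|i]; last by rewrite inE.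
have {EG}Ew : w = om *: f + Q *: \sum_i mu i *: \prod_(j in [set: 'I_r.+1] :\ i) ('X - (- a j)%:P).
  by rewrite -EG scalerA divff // scale1r /G addrC subrK.
pose Pa := \prod_i a i; have Pa0 : 0 < Pa by apply: prodr_gt0.
pose sa := \sum_i a i; pose si := \sum_i (a i)^-1.
pose ms := \sum_i mu i; pose mi := \sum_i mu i / a i.
have f_0 : f`_0 = Q * Pa.
  by rewrite Ef coefZ -/F -EF coef0_prod_XaddC; congr (_ * _); apply: eq_bigl => i; rewrite inE.
have f_1 : f`_1 = Q * (Pa * si) by rewrite Ef coefZ coef1_prod_XaddC.
have f_r : f`_r = Q * sa by rewrite Ef coefZ coefPn_prod_XaddC.
have w_0 : w`_0 = om * (Q * Pa) + Q * (Pa * mi).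
  rewrite Ew coefD !coefZ f_0 coef_sum; congr (_ + _ * _).
  rewrite mulr_sumr; apply: eq_bigr => i _; rewrite coefZ coef0_prod_XaddC.
  rewrite /Pa [in RHS](bigD1 i) //=.
  have -> : \prod_(j in [set: 'I_r.+1] :\ i) a j = \prod_(j | j != i) a j.
    by apply: eq_bigl => j; rewrite !inE andbT.
  by have ai := an i; field.
have w_r : w`_r = om * (Q * sa) + Q * ms.
  rewrite Ew coefD !coefZ f_r coef_sum; congr (_ + _ * _).
  apply: eq_bigr => i _; rewrite coefZ.
  have cE : size (enum ([set: 'I_r.+1] :\ i)) = r.
    have := cardsD1 i [set: 'I_r.+1]; rewrite inE cardsT card_ord add1n => -[E].
    by rewrite -cardE -E.
  set P := \prod_(_ in _) _.
  have Pm : P \is monic by apply: monic_prod => j _; apply: monicXsubC.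
  have sP : size P = r.+1 by rewrite /P -big_enum size_prod_XsubC cE.
  by have := monicP Pm; rewrite lead_coefE sP /= => ->; rewrite mulr1.
have wE : w`_r.+1 = om * Q by rewrite /om divfK.
rewrite /= f_r w_r wE.
(* [Q * ka] is the top coefficient of [f - s w]; with [D] below, the claim becomes
   [s * ms <= ka * D]. *)
pose ka := 1 - s * om.
have mi_ka : s * mi <= ka.
  move: sw0; rewrite f_0 w_0 => H.
  have QP : 0 < Q * Pa by rewrite mulr_gt0.
  rewrite -(ler_pM2r QP) /ka; nra.
have si_r : s * si <= r.+1%:R.
  move: sf1; rewrite f_0 f_1 => H.
  have QP : 0 < Q * Pa by rewrite mulr_gt0.
  rewrite -(ler_pM2r QP); nra.
pose D := sa - s * (r.+1%:R - 2).
have aD i : a i <= D.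
  have term j : 0 <= a j - 2 * s + s ^+ 2 / a j.
    have -> : a j - 2 * s + s ^+ 2 / a j = (a j - s) ^+ 2 / a j by have aj := an j; field.
    by rewrite divr_ge0 ?sqr_ge0 ?ltW.
  have : a i - 2 * s <= \sum_j (a j - 2 * s + s ^+ 2 / a j).
    rewrite (bigD1 i) //= -[X in X <= _]addr0 lerD ?sumr_ge0 //.
    by rewrite lerDl divr_ge0 ?sqr_ge0 ?ltW.
  rewrite !big_split /= sumr_const card_ord -mulr_sumr -/sa -/si -[- (2 * s) *+ _]mulr_natr => H.
  have : s * (s * si) <= s * r.+1%:R by rewrite ler_wpM2l // ltW.
  rewrite /D; move: H; rewrite expr2; move: (r.+1%:R : R) => rr; nra.
have D0 : 0 <= D by apply: le_trans (ltW (a0 ord0)) (aD ord0).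
(* Since [a i <= D], each [mu i] is at most [mu i / a i * D], and [mi_ka] bounds the sum of the
   quotients. *)
have msD : s * ms <= ka * D.
  apply: le_trans (_ : s * mi * D <= _); last exact: ler_wpM2r.
  rewrite -mulrA ler_wpM2l ?(ltW s0) // /ms /mi mulr_suml; apply: ler_sum => i _.
  by rewrite -mulrA ler_peMr // mulrC ler_pdivlMr // mul1r.
rewrite -subr_ge0.
have -> : Q * sa - s * (om * (Q * sa) + Q * ms) - s * (r.+1%:R - 2) * (Q - s * (om * Q)) =
   Q * (ka * D - s * ms) by rewrite /ka /D; ring.
by rewrite mulr_ge0 ?(ltW Q0) // subr_ge0.
Qed.

End BarrierStep.

(** * Barriers under differentiation and averaging *)

Section Barrier.
Variables (V : finType) (R : rcfType).
Local Open Scope complex_scope.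
Notation toC := (real_complex R).
Notation evR := (ev idfun).
Notation evC := (ev toC).
Notation CP := (map_poly toC).
Implicit Types (c : {set V} -> R) (A U W : {set V}) (u v k : V) (x : V -> R).

(** At a zero of [c] the right side of [stable_Im_closed] vanishes, hence so does the derivative in
    any variable of [A]; repeat. It is used to deduce that [c] does not vanish from the same fact
    for [pd A c]. *)
Lemma stable_vanish W A c (z : V -> R[i]) : stable W c -> A \subset W ->
  (forall i, 0 <= imc (z i)) -> (forall k, k \in A -> 0 < imc (z k)) ->
  evC c z = 0 -> evC (pd A c) z = 0.
Proof.
have [n] := ubnP #|A|; elim: n => // n IH in W A c *; rewrite ltnS => An st AW z0 zA E.
have [->|/set0Pn[k kA]] := eqVneq A set0; first by rewrite pd0.
have kW := subsetP AW k kA.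
have E1 : evC (pd [set k] c) z = 0.
  have := stable_Im_closed st kW z0; rewrite E mul0r pmulr_rle0 ?zA // => H.
  by apply/eqP; rewrite -normc2_eq0 eq_le H normc2_ge0.
rewrite -(setD1K kA) setUC -pd_pd; last by rewrite disjoint_sym disjoints1 !inE eqxx.
apply: (IH (W :\ k)) => //.
- by move: An; rewrite (cardsD1 k) kA.
- by apply: stable_pd; rewrite ?sub1set.
- exact: setSD.
- by move=> i /setD1P[_]; apply: zA.
Qed.

(** The coefficients of degree 0, 1, [#|A|.-1] and [#|A|] of this restriction to a line are the
    quantities compared in [row_inequality]. *)
Definition line A c x : {poly R} :=
  ev polyC c (fun v => (x v)%:P + 'X *+ (v \in A)).

Lemma horner_lineC A c x (z : R[i]) :
  (CP (line A c x)).[z] = evC c (fun v => (x v)%:C + z *+ (v \in A)).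
Proof.
rewrite /line (ev_morph polyC CP) /ev horner_sum; apply: eq_bigr => S _.
rewrite hornerM horner_prod /= map_polyC hornerC; congr (_ * _).
apply: eq_bigr => i _; rewrite /= rmorphD rmorphMn /= map_polyX map_polyC.
by rewrite hornerD hornerC hornerMn hornerX.
Qed.

Lemma lineE A c x :
  line A c x = \sum_(U : {set V} | U \subset A) evR (pd U c) x *: 'X^#|U|.
Proof.
rewrite /line ev_taylor [RHS]big_mkcond; apply: eq_bigr => U _.
have -> : ev polyC (pd U c) (fun v => (x v)%:P) = (evR (pd U c) x)%:P.
  by rewrite (ev_morph idfun (@polyC R)).
case: ifP => [UA|/negbT/subsetPn[i iU iA]]; last first.
  by rewrite (bigD1 i) //= (negbTE iA) mulr0n mul0r mulr0.
rewrite mul_polyC; congr (_ *: _).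
rewrite (eq_bigr (fun=> 'X)) ?prodr_const // => i iU.
by rewrite (subsetP UA).
Qed.

Lemma coef_line A c x m :
  (line A c x)`_m = \sum_(U : {set V} | (U \subset A) && (#|U| == m)) evR (pd U c) x.
Proof.
rewrite lineE coef_sum [RHS]big_mkcondr /=; apply: eq_bigr => U _.
by rewrite coefZ coefXn eq_sym; case: eqP; rewrite ?mulr1 ?mulr0.
Qed.

Lemma coef_line0 A c x : (line A c x)`_0 = evR c x.
Proof.
rewrite coef_line (big_pred1 set0) ?pd0 // => U /=.
by rewrite cards_eq0 andbC; case: eqP => // ->; rewrite sub0set.
Qed.

Lemma coef_line1 A c x : (line A c x)`_1 = \sum_(k in A) evR (pd [set k] c) x.
Proof.
rewrite coef_line.
transitivity (\sum_(U in [set [set k] | k in A]) evR (pd U c) x); last first.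
  by rewrite big_imset // => k k' _ _; apply: set1_inj.
apply: eq_bigl => U; apply/andP/imsetP => [[UA /cards1P[k Uk]]|[k kA ->]].
  by exists k => //; rewrite -sub1set -Uk.
by rewrite sub1set cards1.
Qed.

Lemma coef_line_top A c x : (line A c x)`_#|A| = evR (pd A c) x.
Proof.
rewrite coef_line (big_pred1 A) // => U /=; apply/andP/eqP => [[UA /eqP E]|->] //.
by apply/eqP; rewrite eqEcard UA E leqnn.
Qed.

Lemma coef_line_pred A c x : (0 < #|A|)%N ->
  (line A c x)`_#|A|.-1 = \sum_(k in A) evR (pd (A :\ k) c) x.
Proof.
move=> A0; rewrite coef_line.
transitivity (\sum_(U in [set A :\ k | k in A]) evR (pd U c) x); last first.
  rewrite big_imset // => k k' kA kA' /= E; apply/eqP; apply: contraT => kk'.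
  by have := setD11 k A; rewrite E !inE kk' kA.
apply: eq_bigl => U; apply/andP/imsetP => [[UA /eqP UE]|[k kA ->]]; last first.
  by rewrite subsetDl [X in _ == X.-1](cardsD1 k) kA.
have : #|A :\: U| == 1%N by rewrite cardsD (setIidPr UA) UE; apply/eqP; lia.
case/cards1P => k Ek; have kA : k \in A.
  by have := set11 k; rewrite -Ek inE => /andP[].
by exists k; rewrite // -Ek setDDr setDv set0U (setIidPr UA).
Qed.

Lemma size_line A c x : (size (line A c x) <= #|A|.+1)%N.
Proof.
rewrite lineE; apply: leq_trans (size_sum _ _ _) _; apply/bigmax_leqP => U UA.
apply: leq_trans (size_scale_leq _ _) _.
by rewrite size_polyXn ltnS subset_leq_card.
Qed.

(* The second condition bounds the barrier function [d_v c / c] by [1 / s]. *)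
Definition barrier W s c x :=
  (forall U, U \subset W -> 0 < evR (pd U c) x) /\
  (forall v, v \in W -> s * evR (pd [set v] c) x <= evR c x).

(** Differentiating in [u] does not increase the barrier function of [v]: this is [rayleigh] divided
    by [c] times its derivative in [u]. *)
Lemma barrier_pd1 W s u c x : 0 < s -> stable W c -> u \in W ->
  barrier W s c x -> barrier (W :\ u) s (pd [set u] c) x.
Proof.
move=> s0 st uW [pos bar]; split=> [U|v /setD1P[vu vW]].
  rewrite subsetD1 => /andP[UW uU]; rewrite pd_pd; last by rewrite disjoint_sym disjoints1.
  by apply: pos; rewrite subUset UW sub1set.
have c0 : 0 < evR c x by have := pos set0 (sub0set _); rewrite pd0.
have cu : 0 < evR (pd [set u] c) x by apply: pos; rewrite sub1set.
rewrite -(ler_pM2l c0) mulrCA.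
apply: le_trans (_ : s * (evR (pd [set u] c) x * evR (pd [set v] c) x) <= _).
  by rewrite ler_wpM2l ?(ltW s0) // (rayleigh x st vW) // eq_sym.
by rewrite mulrCA mulrC ler_wpM2r ?(ltW cu) // bar.
Qed.

Lemma barrier_pd W U s c x : 0 < s -> stable W c -> U \subset W ->
  barrier W s c x -> barrier (W :\: U) s (pd U c) x.
Proof.
move=> s0; have [n] := ubnP #|U|; elim: n => // n IH in W U c *; rewrite ltnS => Un st UW bar.
have [->|/set0Pn[u uU]] := eqVneq U set0; first by rewrite pd0 setD0.
have uW := subsetP UW u uU.
rewrite -(setD1K uU) -[in barrier _](setDDl W) setUC -pd_pd; last first.
  by rewrite disjoint_sym disjoints1 !inE eqxx.
apply: IH; first by move: Un; rewrite (cardsD1 u) uU.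
- by apply: stable_pd; rewrite ?sub1set.
- exact: setSD.
- exact: barrier_pd1.
Qed.

Definition lower A (t : R) x : V -> R := fun v => x v - t *+ (v \in A).

(** Among the variables of [A], the term of [k] involves only [k], affinely and with slope [pd A c];
    lowering it by [t] costs [t] times that slope. *)
Lemma ev_avg_lower A c x t :
  evR (avg A c) (lower A t x) =
  \sum_(k in A) evR (pd (A :\ k) c) x - t * #|A|%:R * evR (pd A c) x.
Proof.
rewrite /avg ev_sum mulrAC mulr_natr -sumr_const -sumrB; apply: eq_bigr => k kA.
rewrite -(pd1_setD1 c kA) -mulNr -ev_shift; apply: ev_pd_ext => i.
rewrite !inE negb_and negbK /lower => iA; congr (_ + _); rewrite mulNrn; congr (- (_ *+ _)).
by congr nat_of_bool; have [->|] := eqVneq i k; [rewrite kA|move: iA; case: eqP => //= _ /negbTE].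
Qed.

Lemma barrier_avg W A s c x : 0 < s -> stable W c -> A \subset W -> (1 < #|A|)%N ->
  barrier W s c x ->
  barrier (W :\: A) s (avg A c) (lower A (s * (1 - 2 / #|A|%:R)) x).
Proof.
move=> s0 st AW A2 bar; set r := #|A| in A2 *; set t := s * _.
have r0 : (0 < r)%N by apply: ltnW.
have rn : r%:R != 0 :> R by rewrite pnatr_eq0 -lt0n.
have tr : t * r%:R = s * (r%:R - 2) by rewrite /t; field.
have Ak k : k \in A -> A :\ k \subset W by move=> _; apply: subset_trans AW; rewrite subsetDl.
split=> [U|v].
  rewrite subsetD => /andP[UW dU]; rewrite pd_avg ev_avg_lower -/r tr.
  have AU : A \subset W :\: U by rewrite subsetD AW disjoint_sym.
  have [pos _] := barrier_pd s0 st UW bar.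
  (* [pd A] is the derivative in [k] of [pd (A :\ k)], which inherits the barrier. Summed over [k]
     this gives [r s] times [pd A], more than the loss of [s (r - 2)] times it. *)
  have sQ k : k \in A -> s * evR (pd A (pd U c)) x <= evR (pd (A :\ k) (pd U c)) x.
    move=> kA; have AkU : A :\ k \subset W :\: U by apply: subset_trans AU; rewrite subsetDl.
    have [_] := barrier_pd s0 (stable_pd st UW) AkU (barrier_pd s0 st UW bar).
    move=> /(_ k); rewrite pd1_setD1 //; apply.
    by rewrite !inE eqxx /=; have := subsetP AU _ kA; rewrite inE.
  have Q0 : 0 < evR (pd A (pd U c)) x by apply: pos.
  have : \sum_(k in A) s * evR (pd A (pd U c)) x <= \sum_(k in A) evR (pd (A :\ k) (pd U c)) x.
    by apply: ler_sum.
  rewrite sumr_const -/r -[_ *+ r]mulr_natr.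
  have := mulr_gt0 s0 Q0; move: (r%:R : R) => rr; nra.
rewrite inE => /andP[vA vW]; rewrite pd_avg !ev_avg_lower -/r tr.
(* The barrier condition at [v] for the average is a rearrangement of the conclusion of
   [row_inequality] for these two polynomials. *)
pose f := line A c x; pose w := line A (pd [set v] c) x.
have [pos bar1] := bar.
have cx (a : {set V} -> R) z : evC a (fun u => (x u)%:C + z *+ (u \in A)) = (CP (line A a x)).[z].
  by rewrite horner_lineC.
have Qpos : 0 < evR (pd A c) x by apply: pos.
have fr : f`_r = evR (pd A c) x by apply: coef_line_top.
have sf : size f = r.+1.
  apply/eqP; rewrite eqn_leq size_line ltnNge; apply/negP => /leq_sizeP/(_ r (leqnn _)).
  by rewrite fr => E; rewrite E ltxx in Qpos.
have im_ge0 z : 0 < imc z -> forall u, 0 <= imc ((x u)%:C + z *+ (u \in A)).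
  by move=> z0 u; rewrite ImcD /= add0r; case: (u \in A) => //=; rewrite ltW.
have im_gt0 z : 0 < imc z -> forall u, u \in A -> 0 < imc ((x u)%:C + z *+ (u \in A)).
  by move=> z0 u uA; rewrite ImcD /= add0r uA.
have := @row_inequality R f w r s r0 s0 sf.
rewrite fr !coef_line_top !coef_line_pred // !coef_line0 coef_line1 -/r.
move=> H; rewrite -subr_ge0; have {H} := H Qpos (size_line _ _ _).
move=> /(_ _ _ _ (bar1 v vW)) H.
apply: le_trans (_ : 0 <= (\sum_(k in A) evR (pd (A :\ k) c) x -
   s * \sum_(k in A) evR (pd (A :\ k) (pd [set v] c)) x) -
   s * (r%:R - 2) * (evR (pd A c) x - s * evR (pd A (pd [set v] c)) x)) _.
  rewrite subr_ge0; apply: H.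
  - move=> t0 t00; rewrite /f lineE horner_sum (bigD1 set0) ?sub0set //= pd0.
    rewrite cards0 hornerZ hornerXn expr0 mulr1 ltr_pwDl //.
      by have := pos set0 (sub0set _); rewrite pd0.
    apply: sumr_ge0 => U /andP[UA _]; rewrite hornerZ hornerXn mulr_ge0 ?exprn_ge0 //.
    by rewrite ltW // pos // (subset_trans UA).
  (* A zero of [f] would make [pd A c] vanish; but this does not depend on the variables of [A], so
     its value is the positive one at [x]. *)
  - move=> z z0; rewrite -cx; apply/negP => /eqP E.
    have := stable_vanish st AW (im_ge0 z z0) (im_gt0 z z0) E.
    rewrite (@ev_pd_ext _ _ _ _ A _ _ (fun u => (x u)%:C)); last first.
      by move=> i /negbTE ->; rewrite addr0.
    by rewrite evC_real => /complexI E1; rewrite E1 ltxx in Qpos.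
  (* As [v] lies outside [A], its variable stays real and the left side of [stable_Im_closed] is
     0. *)
  - move=> z z0; rewrite -!cx.
    have := stable_Im_closed st vW (im_ge0 z z0).
    rewrite (negbTE vA) mulr0n addr0 /= mul0r.
    set a := evC c _; set b := evC _ _; case: a b => [a1 a2] [b1 b2] /=; lra.
  - rewrite mulr_sumr mulr_natl -sumr_const; apply: ler_sum => k kA.
    by apply: bar1; apply: (subsetP AW).
by rewrite le_eqVlt; apply/orP; left; apply/eqP; ring.
Qed.

End Barrier.

(** * Processing all rows *)

Section Rows.
Variables (R : rcfType) (n r : nat).
Notation V := ('I_n * 'I_r)%type.
Notation evR := (ev idfun).
Implicit Types (c : {set V} -> R) (U W : {set V}) (s : seq 'I_n).

Definition rows s : {set V} := [set p | p.1 \in s].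

Definition avgs s c := foldr (fun i c => avg (rows [:: i]) c) c s.

Lemma rows_cons i s : rows (i :: s) = rows [:: i] :|: rows s.
Proof. by apply/setP => p; rewrite !inE. Qed.

Lemma rows_disjoint i s : i \notin s -> [disjoint rows [:: i] & rows s].
Proof.
move=> si; rewrite -setI_eq0; apply/eqP/setP => p; rewrite !inE.
by case: eqP => // ->; rewrite (negbTE si).
Qed.

Lemma card_row i : #|rows [:: i]| = r.
Proof.
have -> : rows [:: i] = [set (i, k) | k in 'I_r].
  apply/setP => -[j k]; rewrite !inE /=; apply/eqP/imsetP => [->|[k' _ [-> _]] //].
  by exists k.
by rewrite card_imset ?card_ord // => k k' [].
Qed.

Lemma pd_avgs U s c : pd U (avgs s c) = avgs s (pd U c).
Proof. by elim: s => //= i s IH; rewrite pd_avg IH. Qed.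

Lemma row_in_compl W i s : i \notin s -> rows (i :: s) \subset W ->
  rows [:: i] \subset W :\: rows s.
Proof. by rewrite rows_cons subUset subsetD => /rows_disjoint -> /andP[->]. Qed.

Lemma row_neq0 i : (0 < r)%N -> rows [:: i] != set0.
Proof. by rewrite -card_gt0 card_row. Qed.

Lemma avgs_stable W d l s c : (0 < r)%N -> uniq s -> rows s \subset W -> 0 < l ->
  stable W c -> leading W d l c ->
  stable (W :\: rows s) (avgs s c) /\
  exists d', exists2 l', 0 < l' & leading (W :\: rows s) d' l' (avgs s c).
Proof.
move=> r0 us sW l0 st ld; elim: s us sW => [_ _|i s IH /= /andP[si us] isW].
  have -> : rows [::] = set0 by apply/setP => p; rewrite !inE.
  by rewrite setD0; split=> //; exists d, l.
have iW := row_in_compl si isW.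
move: isW; rewrite rows_cons subUset => /andP[_ /(IH us)[{}st [d' [l' l'0 {}ld]]]].
rewrite setUC -setDDl; split; first exact: (stable_avg st iW (row_neq0 _ r0)).
exists (d' - #|rows [:: i]|.-1)%N, (l' *+ #|rows [:: i]|).
  by rewrite pmulrn_lgt0 // card_row.
exact: (leading_avg ld iW (row_neq0 _ r0)).
Qed.

Lemma avgs_barrier W d l b s (x : V -> R) c :
  (1 < r)%N -> uniq s -> rows s \subset W -> 0 < l -> 0 < b ->
  stable W c -> leading W d l c -> barrier W b c x ->
  barrier (W :\: rows s) b (avgs s c) (lower (rows s) (b * (1 - 2 / r%:R)) x).
Proof.
move=> r1 us sW l0 b0 st ld br; elim: s us sW => [_ _|i s IH /= /andP[si us] isW].
  have -> : rows [::] = set0 by apply/setP => p; rewrite !inE.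
  rewrite setD0 (_ : lower _ _ _ = x) //.
  by apply: funext => v; rewrite /lower inE mulr0n subr0.
have iW := row_in_compl si isW.
move: isW; rewrite rows_cons subUset => /andP[_ sW].
have [{}st _] := avgs_stable (ltnW r1) us sW l0 st ld.
have := barrier_avg b0 st iW; rewrite card_row => /(_ _ r1 (IH us sW)).
rewrite setUC -setDDl; congr (barrier _ _ _ _); apply: funext => p.
(* The rows are disjoint, so each variable is lowered at most once. *)
rewrite /lower -addrA -opprD -mulrnDr; congr (_ - _ *+ _); rewrite !inE.
by case: (eqVneq p.1 i) => [->|]; rewrite ?(negbTE si) ?orbF ?addn0.
Qed.

(** [interlacing] on the outermost row fixes the colour of its index. Derivatives commute with the
    remaining averages, so the induction continues with the differentiated polynomial. *)
Lemma choose_colours W d l b s c : (0 < r)%N -> uniq s -> rows s \subset W -> 0 < l ->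
  stable W c -> leading W d l c -> positive_from b (avgs s c) ->
  exists sigma : 'I_n -> 'I_r,
    positive_from b (pd [set p : V | (p.1 \in s) && (p.2 != sigma p.1)] c).
Proof.
move=> r0; elim: s W d c => [|i s IH] W d c.
  move=> _ _ _ _ _ pos; exists (fun=> Ordinal r0).
  rewrite (_ : finset _ = set0); first by rewrite pd0.
  by apply/setP => p; rewrite !inE.
move=> /= /andP[si us] isW l0 st ld pos.
have iW' := row_in_compl si isW.
move: isW; rewrite rows_cons subUset => /andP[iW sW].
have [st' [d' [l' l'0 ld']]] := avgs_stable r0 us sW l0 st ld.
have [[j k]] := interlacing st' ld' l'0 iW' (row_neq0 _ r0) pos.
rewrite !inE /= => /eqP ->; rewrite pd_avgs; set B := _ :\ _ => pos'.
have BW : B \subset W by apply: subset_trans iW; rewrite subsetDl.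
have sB : rows s \subset W :\: B.
  rewrite subsetD sW disjoint_sym; apply: disjointWl (rows_disjoint si).
  exact: subsetDl.
have [sigma] := IH _ _ _ us sB l0 (stable_pd st BW) (leading_pd ld BW) pos'.
rewrite pd_pd => [pos2|]; last first.
  apply: disjointWl (_ : [disjoint rows s & B]).
    by apply/subsetP => p; rewrite !inE => /andP[].
  by rewrite disjoint_sym; apply: disjointWl (rows_disjoint si); apply: subsetDl.
exists (fun j => if j == i then k else sigma j).
move: pos2; congr (positive_from _ (pd _ _)).
apply/setP => -[j' k']; rewrite !inE /= xpair_eqE.
by case: (eqVneq j' i) => [->|_]; rewrite ?(negbTE si) /= ?andbT ?andbF ?orbF.
Qed.

End Rows.

(** * Hermitian forms *)

Section Forms.
Variables (R : rcfType) (n : nat).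
Local Open Scope complex_scope.
Notation toC := (real_complex R).
Implicit Types (u v w : 'cV[R[i]]_n).

Definition dot u v : R[i] := \sum_i cj (u i 0) * v i 0.
Definition n2 u : R := \sum_i normc2 (u i 0).

Lemma dot_n2 u : dot u u = (n2 u)%:C.
Proof. by rewrite /n2 rmorph_sum; apply: eq_bigr => i _; rewrite mulrC mulcJ. Qed.

Lemma n2_ge0 u : 0 <= n2 u.
Proof. by apply: sumr_ge0 => i _; apply: normc2_ge0. Qed.

Lemma n2_ge_coord u i : normc2 (u i 0) <= n2 u.
Proof.
by rewrite /n2 (bigD1 i) //= lerDl sumr_ge0 // => j _; apply: normc2_ge0.
Qed.

Lemma n2_eq0 u : n2 u <= 0 -> u = 0.
Proof.
move=> u0; apply/colP => i; rewrite mxE; apply/eqP; rewrite -normc2_eq0.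
by rewrite eq_le normc2_ge0 (le_trans (n2_ge_coord u i)).
Qed.

Lemma dotDr u v w : dot u (v + w) = dot u v + dot u w.
Proof. by rewrite /dot -big_split; apply: eq_bigr => i _; rewrite mxE mulrDr. Qed.

Lemma dotZr u (a : R[i]) v : dot u (a *: v) = a * dot u v.
Proof. by rewrite /dot mulr_sumr; apply: eq_bigr => i _; rewrite mxE mulrCA. Qed.

Lemma dotC u v : dot v u = cj (dot u v).
Proof.
rewrite /dot conjc_sum; apply: eq_bigr => i _.
by rewrite conjcM conjcK mulrC.
Qed.

Lemma dotDl u v w : dot (u + v) w = dot u w + dot v w.
Proof. by rewrite dotC dotDr conjcD -!dotC. Qed.

Lemma dotZl (a : R) u v : dot (a%:C *: u) v = a%:C * dot u v.
Proof. by rewrite dotC dotZr conjcM conjc_real -dotC. Qed.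

Lemma dotNr u v : dot u (- v) = - dot u v.
Proof. by rewrite -scaleN1r dotZr mulN1r. Qed.

Lemma dotNl u v : dot (- u) v = - dot u v.
Proof. by rewrite dotC dotNr rmorphN /= -dotC. Qed.

Definition hermitian (B : 'M[R[i]]_n) := forall i j, B j i = cj (B i j).

Variable B : 'M[R[i]]_n.
Hypothesis HB : hermitian B.

Lemma dot_herm u v : dot u (B *m v) = dot (B *m u) v.
Proof.
rewrite /dot; under eq_bigr => i _ do rewrite mxE mulr_sumr.
rewrite exchange_big /=; apply: eq_bigr => j _.
rewrite mxE conjc_sum mulr_suml; apply: eq_bigr => i _.
by rewrite /= conjcM -HB; ring.
Qed.

Definition quad u : R := rec (dot u (B *m u)).

Lemma dot_quad u : dot u (B *m u) = (quad u)%:C.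
Proof.
have : dot u (B *m u) = cj (dot u (B *m u)) by rewrite -dotC dot_herm.
rewrite /quad; case: (dot _ _) => a b [] ab; apply/eqP; 
rewrite eq_complex /= eqxx /=; apply/eqP; lra.
Qed.

Lemma n2_shift (e : R) u :
  n2 (e%:C *: u - B *m u) = e ^+ 2 * n2 u - e * quad u *+ 2 + n2 (B *m u).
Proof.
set a := B *m u; apply: (@complexI R); rewrite -dot_n2.
rewrite !(dotDl, dotDr, dotNl, dotNr, dotZl, dotZr) -[dot a u]dot_herm dot_quad !dot_n2.
by apply/eqP; rewrite eq_complex /=; apply/andP; split; apply/eqP; ring.
Qed.

Lemma quad_shift (e : R) u :
  quad (e%:C *: u - B *m u) =
  e ^+ 2 * quad u - e * n2 (B *m u) *+ 2 + quad (B *m u).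
Proof.
set a := B *m u.
have dE x y : quad (x + y) = quad x + rec (dot x (B *m y)) *+ 2 + quad y.
  apply: (@complexI R); rewrite -dot_quad mulmxDr !(dotDl, dotDr) !dot_quad.
  have -> : dot y (B *m x) = cj (dot x (B *m y)) by rewrite -dotC dot_herm.
  by case: (dot x _) => s t; apply/eqP; rewrite eq_complex /=; apply/andP; split; apply/eqP; ring.
have quadZ (f : R) x : quad (f%:C *: x) = f ^+ 2 * quad x.
  apply: (@complexI R); rewrite -dot_quad -scalemxAr dotZl dotZr dot_quad -!rmorphM /=.
  by congr (_ %:C); ring.
have cross (f : R) : rec (dot (f%:C *: u) (B *m - a)) = - f * n2 a.
  by rewrite mulmxN dotNr dotZl dot_herm dot_n2 -rmorphM -rmorphN /= mulNr.
have quadN x : quad (- x) = quad x.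
  by have := quadZ (-1) x; rewrite rmorphN1 scaleN1r expr2 mulrNN mulr1 mul1r.
by rewrite dE quadZ cross quadN; ring.
Qed.

(** Add the form of [g + B] at [(g - B) u] to that of [g - B] at [(g + B) u]: both are nonnegative,
    and the sum is [2 g (g^2 |u|^2 - |B u|^2)]. *)
Lemma n2_le_quad (g : R) u : 0 < g -> (forall v, - (g * n2 v) <= quad v <= g * n2 v) ->
  n2 (B *m u) <= g ^+ 2 * n2 u.
Proof.
move=> g0 H; have /andP[h1 _] := H (g%:C *: u - B *m u).
have /andP[_ h2] := H ((- g)%:C *: u - B *m u).
rewrite n2_shift quad_shift in h1; rewrite n2_shift quad_shift in h2.
have : 0 <= 2 * g * (g ^+ 2 * n2 u - n2 (B *m u)) by nra.
by rewrite pmulr_rge0 ?subr_ge0 // mulr_gt0.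
Qed.

Hypothesis contr : forall u, n2 (B *m u) <= n2 u.

Lemma quad_contraction u : - n2 u <= quad u <= n2 u.
Proof.
have h1 := n2_ge0 (1%:C *: u - B *m u); have h2 := n2_ge0 ((-1)%:C *: u - B *m u).
rewrite n2_shift in h1; rewrite n2_shift in h2; have := contr u => h3.
apply/andP; split; nra.
Qed.

(* [(b^2 - 1) (b - B)^-1 <= b + B], evaluated at [(b - B) u]: the difference of the
   two sides is [b (|u|^2 - |B u|^2) + <B u, B (B u)> - <u, B u>], in which
   [|u|^2 - |B u|^2 + <B u, B (B u)> - <u, B u>] is the form of [1 + B] at
   [u - B u]. *)
Lemma resolvent_bound (b : R) u : 1 < b ->
  (b ^+ 2 - 1) * (b * n2 u - quad u) <=
  b * n2 (b%:C *: u - B *m u) + quad (b%:C *: u - B *m u).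
Proof.
move=> b1; set a := B *m u.
have /andP[pos _] := quad_contraction (1%:C *: u - a).
rewrite n2_shift quad_shift in pos; rewrite n2_shift quad_shift; have := contr u => c1.
nra.
Qed.

End Forms.

(** * Minors of a Hermitian contraction *)

Section MaskedDeterminant.
Variables (R : rcfType) (n : nat) (A : 'M[R[i]]_n).
Local Open Scope complex_scope.
Notation toC := (real_complex R).
Implicit Types (y : 'I_n -> R[i]) (S : {set 'I_n}) (u : 'cV[R[i]]_n) (v : 'I_n).

(* [diag y - A] with the rows and columns indexed by [S] replaced by those of
   the identity, so that its determinant is the minor on the complement of [S]. *)
Definition masked y S : 'M[R[i]]_n :=
  \matrix_(i, j) if (i \in S) || (j \in S) then (i == j)%:R else y i *+ (i == j) - A i j.

Definition mask S u : 'cV[R[i]]_n := \col_i (if i \in S then 0 else u i 0).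

Lemma maskE S u i : mask S u i 0 = if i \in S then 0 else u i 0.
Proof. by rewrite mxE. Qed.

Lemma det_masked_setU1 y S v : v \notin S ->
  \det (masked y (v |: S)) = cofactor (masked y S) v v.
Proof.
move=> vS; rewrite (expand_det_row _ v) (bigD1 v) //= [X in _ + X]big1 ?addr0 => [|j jv].
  rewrite mxE !inE eqxx /= mul1r; congr (_ * \det _).
  by apply/matrixP => i j; rewrite !mxE !inE ![lift v _ == v]eq_sym !(negbTE (neq_lift _ _)).
by rewrite mxE !inE eqxx /= eq_sym (negbTE jv) mul0r.
Qed.

(** Expanding along row [v] shows the determinant to be affine in [y v], with slope the minor
    omitting [v]; for [v] in [S] the entry [y v] does not occur. *)
Lemma det_masked_shift y S v t :
  \det (masked (fun i => y i + t *+ (i == v)) S) =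
  if v \in S then \det (masked y S) else \det (masked y S) + t * \det (masked y (v |: S)).
Proof.
case: ifP => vS.
  congr (\det _); apply/matrixP => i j; rewrite !mxE; case: ifP => // /norP[iS _].
  have [iv|_] := eqVneq i v; last by rewrite addr0.
  by rewrite iv vS in iS.
move/negbT: vS => vS; rewrite det_masked_setU1 //.
rewrite !(expand_det_row _ v) (bigD1 v) //= [in RHS](bigD1 v) //=.
set y' := fun i => _.
have cof j : cofactor (masked y' S) v j = cofactor (masked y S) v j.
  congr (_ * \det _); apply/matrixP => i k; rewrite !mxE /y'.
  by rewrite [lift v _ == v]eq_sym (negbTE (neq_lift _ _)) addr0.
rewrite cof (eq_bigr (fun j => masked y S v j * cofactor (masked y S) v j)) => [|j jv].
  by rewrite !mxE (negbTE vS) /= /y' !eqxx !mulr1n; ring.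
by rewrite cof !mxE /y' [v == j]eq_sym (negbTE jv) !mulr0n.
Qed.

Lemma det_masked_setT y : \det (masked y [set: 'I_n]) = 1.
Proof.
rewrite (_ : masked _ _ = 1%:M) ?det1 //.
by apply/matrixP => i j; rewrite !mxE inE.
Qed.

Lemma dot_masked y S u :
  dot u (masked y S *m u) =
  \sum_i (if i \in S then 1 else y i) * (normc2 (u i 0))%:C -
  dot (mask S u) (A *m mask S u).
Proof.
rewrite /dot -sumrB; apply: eq_bigr => i _; rewrite mxE [in RHS]mxE [in RHS]mxE -mulcJ.
case: ifP => iS.
  rewrite rmorph0 mul0r subr0 (bigD1 i) //= big1 ?addr0 => [|j ji]; last first.
    by rewrite mxE iS /= eq_sym (negbTE ji) mul0r.
  by rewrite mxE iS eqxx /=; ring.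
have -> : \sum_j masked y S i j * u j 0 = y i * u i 0 - \sum_j A i j * mask S u j 0.
  rewrite (bigD1 i) //= [in RHS](bigD1 i) //= !mxE iS /= eqxx mulr1n.
  rewrite mulrBl opprD addrA; congr (_ + _); rewrite -sumrN; apply: eq_bigr => j ji.
  rewrite !mxE iS /= eq_sym (negbTE ji) mulr0n sub0r; case: ifP => _; ring.
by ring.
Qed.

Hypothesis HA : hermitian A.

Lemma det_masked_real (x : 'I_n -> R) S :
  imc (\det (masked (fun i => (x i)%:C) S)) = 0.
Proof.
set B := masked _ _.
have EB : map_mx (@conjc R) B^T = B.
  apply/matrixP => i j; rewrite !mxE orbC; case: ifP => _.
    by rewrite eq_sym; case: eqP; rewrite /= oppr0.
  rewrite rmorphB /= -HA; congr (_ - _).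
  by have [->|ij] := eqVneq i j; rewrite ?eqxx /= ?oppr0 // eq_sym (negbTE ij) /= oppr0.
have : \det B = cj (\det B) by rewrite -{1}EB (det_map_mx (@conjc R)) det_tr.
case: (\det B) => a b [] /= ?; lra.
Qed.

(** A kernel vector vanishes on [S]. The form of [A] is real, so the imaginary part of the whole
    form is a sum of [imc (y i)] weighted by squared moduli, which is positive. *)
Lemma det_masked_upper y S : (forall i, 0 < imc (y i)) -> \det (masked y S) != 0.
Proof.
move=> y0; apply/negP; rewrite -det_tr => /det0P[w w0 wM].
pose u := w^T; have Mu : masked y S *m u = 0.
  by apply: trmx_inj; rewrite trmx_mul trmxK wM trmx0.
have u0 : u != 0 by apply: contra w0 => /eqP E; rewrite -[w]trmxK -/u E trmx0.
have uS i : i \in S -> u i 0 = 0.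
  move=> iS; move/colP/(_ i): Mu; rewrite mxE (bigD1 i) //= big1 ?addr0 => [|j ji].
    by rewrite mxE iS eqxx mul1r => ->; rewrite mxE.
  by rewrite mxE iS /= eq_sym (negbTE ji) mul0r.
have := dot_masked y S u; rewrite Mu dot_quad //.
have -> : dot u 0 = 0 by rewrite /dot big1 // => i _; rewrite [X in _ * X]mxE mulr0.
move/(congr1 (fun z => imc z)); rewrite ImcB Imc_sum /= subr0 => E.
have [i ui] : exists i, u i 0 != 0.
  apply/existsP; apply: contraR u0 => /existsPn H; apply/eqP/colP => i.
  by rewrite [RHS]mxE; have := H i; rewrite negbK => /eqP.
have iS : i \notin S by apply: contra ui => /uS ->.
suff : 0 < \sum_i imc ((if i \in S then 1 else y i) * (normc2 (u i 0))%:C).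
  by rewrite -E ltxx.
rewrite (bigD1 i) //= ltr_pwDl //.
  by rewrite (negbTE iS) mulrC ImcZ mulr_gt0 ?normc2_gt0.
apply: sumr_ge0 => j _; rewrite mulrC ImcZ mulr_ge0 ?normc2_ge0 //.
by case: ifP => // _; apply: ltW.
Qed.

Hypothesis contr : forall u, n2 (A *m u) <= n2 u.

Definition rdet (b : R) S : R := rec (\det (masked (fun=> b%:C) S)).

Lemma rdetE b S : \det (masked (fun=> b%:C) S) = (rdet b S)%:C.
Proof.
have := @det_masked_real (fun=> b) S; rewrite /rdet.
by case: (\det _) => a c /= ->.
Qed.

Lemma masked_col_adj y S v :
  masked y S *m col v (\adj (masked y S)) = \det (masked y S) *: delta_mx v 0.
Proof. by rewrite colE mulmxA mul_mx_adj mul_scalar_mx. Qed.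

Lemma rdet_adj b S v : v \notin S ->
  (\adj (masked (fun=> b%:C) S)) v v = (rdet b (v |: S))%:C.
Proof. by move=> vS; rewrite mxE -det_masked_setU1 // rdetE. Qed.

Lemma dot_delta u v : dot u (delta_mx v 0) = cj (u v 0).
Proof.
rewrite /dot (bigD1 v) //= big1 ?addr0 => [|i iv]; first by rewrite mxE !eqxx mulr1.
by rewrite mxE (negbTE iv) mulr0.
Qed.

(** Induction on the complement of [S]. At column [v] of the adjugate the form of the masked matrix
    is the product of [rdet b S] and [rdet b (v |: S)], and the form is positive there because [A]
    is a contraction and [b > 1]. *)
Lemma rdet_gt0 b S : 1 < b -> 0 < rdet b S.
Proof.
move=> b1; have [m] := ubnP #|~: S|; elim: m => // m IH in S *; rewrite ltnS => Sm.
have [->|] := eqVneq S [set: 'I_n].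
  by rewrite /rdet det_masked_setT ltr01.
rewrite -subTset => /subsetPn[v _ vS].
have D0 : 0 < rdet b (v |: S).
  apply: IH; apply: leq_trans Sm; rewrite setCU setIC -setDE (cardsD1 v (~: S)).
  by rewrite inE vS.
set B := masked (fun=> b%:C) S; pose u := col v (\adj B).
have uv : u v 0 = (rdet b (v |: S))%:C by rewrite mxE rdet_adj.
have := dot_masked (fun=> b%:C) S u.
rewrite masked_col_adj rdetE dotZr dot_delta uv conjc_real -rmorphM dot_quad //.
set X := \sum_i _; have EX : X = (\sum_i (if i \in S then 1 else b) * normc2 (u i 0))%:C.
  rewrite rmorph_sum; apply: eq_bigr => i _.
  by case: ifP => _; rewrite rmorphM.
rewrite EX -rmorphB => /complexI E.
rewrite -(pmulr_lgt0 _ D0) E subr_gt0.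
have /andP[_ q] := quad_contraction HA contr (mask S u).
apply: le_lt_trans q _; rewrite /n2 (bigD1 v) //= [X in _ < X](bigD1 v) //= !maskE (negbTE vS) uv.
rewrite ltr_leD //.
  rewrite -[X in X < _]mul1r ltr_pM2r // normc2_gt0.
  by apply/eqP => -[E0]; rewrite E0 ltxx in D0.
apply: ler_sum => i _; rewrite maskE; case: ifP => _; last first.
  by rewrite ler_peMl ?normc2_ge0 // ltW.
by rewrite mul1r (_ : normc2 0 = 0) ?normc2_ge0 //; apply/eqP; rewrite normc2_eq0.
Qed.

Hypothesis A0 : forall i, A i i = 0.

(** Apply [resolvent_bound] to column [v] of the adjugate, which [b - A] maps to a multiple of the
    basis vector at [v]. The zero diagonal of [A] kills the last term of the bound. *)
Lemma rdet_barrier b v : 1 < b -> (b - b^-1) * rdet b [set v] <= rdet b set0.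
Proof.
move=> b1; set B := masked (fun=> b%:C) set0; pose u := col v (\adj B).
have D0 : 0 < rdet b set0 by apply: rdet_gt0.
have uv : u v 0 = (rdet b [set v])%:C by rewrite mxE rdet_adj ?inE ?setU0.
have EB : B *m u = b%:C *: u - A *m u.
  rewrite -mul_scalar_mx -mulmxBl; congr (_ *m _); apply/matrixP => i j.
  by rewrite !mxE !inE.
have Bu : B *m u = (rdet b set0)%:C *: delta_mx v 0 by rewrite masked_col_adj rdetE.
have E1 : rdet b [set v] * rdet b set0 = b * n2 u - quad A u.
  apply: (@complexI R); rewrite mulrC rmorphM /= -[X in _ * X]conjc_real -uv.
  rewrite -dot_delta -dotZr -Bu EB dotDr dotNr dotZr dot_n2 dot_quad //.
  by rewrite -rmorphM -rmorphB.
have E2 : n2 (B *m u) = rdet b set0 ^+ 2.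
  apply: (@complexI R); rewrite -dot_n2 Bu dotZl dotZr dot_delta !mxE !eqxx.
  by rewrite conjc1 mulr1 -rmorphM.
have E3 : quad A (B *m u) = 0.
  rewrite /quad Bu -scalemxAr dotZl dotZr dotC dot_delta -colE mxE A0 conjc0 conjc0 !mulr0 //.
have := resolvent_bound HA contr u b1; rewrite -EB E3 E2 -E1 addr0.
set d := rdet b set0 in D0 *; set e := rdet b _.
have b0 : 0 < b by apply: lt_trans b1.
rewrite expr2 [_ ^+ 2]expr2 mulrA [b * (d * d)]mulrA ler_pM2r // => H.
have -> : (b - b^-1) * e = (b * b - 1) * e / b by field; rewrite gt_eqF.
by rewrite ler_pdivrMr // [d * b]mulrC.
Qed.

End MaskedDeterminant.

(** * Recognising the derivatives of a multi-affine polynomial *)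

Section DerivativeSystem.
Variables (V : finType) (R : rcfType).
Notation toC := (real_complex R).

(** The shift rule and the values at 0 determine the family: induction on the number of nonzero
    coordinates of [z], resetting one of them to 0 at each step. *)
Lemma ev_derivative_system (P : {set V} -> (V -> R[i]) -> R[i]) (c : {set V} -> R) :
  (forall U z v t, P U (fun i => z i + t *+ (i == v)) =
     if v \in U then P U z else P U z + t * P (v |: U) z) ->
  (forall U, P U (fun=> 0) = toC (c U)) ->
  forall U z, ev toC (pd U c) z = P U z.
Proof.
move=> shiftP P0 U z; have [m] := ubnP #|[set v | z v != 0]|.
elim: m => // m IH in U z *; rewrite ltnS => zm.
have [|[v vz]] := set_0Vmem [set v | z v != 0].
  move=> z0; have {z0 zm}-> : z = (fun=> 0).
    by apply: funext => v; move/setP/(_ v): z0; rewrite !inE => /negbFE/eqP.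
  rewrite P0 /ev (bigD1 set0) //= big_set0 mulr1 big1 ?addr0 => [|S /set0Pn[v vS]].
    by rewrite /pd -setI_eq0 setI0 eqxx setU0.
  by rewrite (bigD1 v) //= mul0r mulr0.
pose z0 i := if i == v then 0 else z i.
have Ez : z = (fun i => z0 i + z v *+ (i == v)).
  by apply: funext => i; rewrite /z0; case: eqP => [->|]; rewrite ?add0r ?addr0.
have z0m : (#|[set i | (z0 i != 0)%R]| < m)%N.
  apply: leq_trans zm; apply: proper_card; apply/properP; split.
    by apply/subsetP => i; rewrite !inE /z0; case: (i == v) => //; rewrite eqxx.
  by exists v; rewrite // inE /z0 !eqxx.
rewrite Ez ev_shift shiftP !IH //; case: ifP => vU.
  rewrite pd_meet ?ev_const0 ?mulr0 ?addr0 //.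
  by rewrite disjoints1 negbK.
by rewrite pd_pd ?disjoints1 ?vU // IH.
Qed.

End DerivativeSystem.

(** * The product of determinants and the choice of a colouring *)

Section OneSided.
Variables (R : rcfType) (n r : nat) (A : 'M[R[i]]_n).
Local Open Scope complex_scope.
Notation toC := (real_complex R).
Notation V := ('I_n * 'I_r)%type.
Notation evR := (ev idfun).
Notation evC := (ev toC).
Hypothesis HA : hermitian A.
Implicit Types (U : {set V}) (z : V -> R[i]).

Definition slice U (k : 'I_r) : {set 'I_n} := [set i | (i, k) \in U].

(** The product polynomial with all its derivatives: differentiating in [(i, k)] removes the index
    [i] from the factor of colour [k]. *)
Definition minors U z : R[i] :=
  \prod_k \det (masked A (fun i => z (i, k)) (slice U k)).

Definition minors_coef U : R := rec (minors U (fun=> 0)).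

Lemma minors_shift U z v t :
  minors U (fun i => z i + t *+ (i == v)) =
  if v \in U then minors U z else minors U z + t * minors (v |: U) z.
Proof.
case: v => i k; rewrite /minors !(bigD1 k (P := predT)) //=.
have Ek : (fun i' => z (i', k) + t *+ ((i', k) == (i, k))) =
          (fun i' => z (i', k) + t *+ (i' == i)).
  by apply: funext => i'; rewrite xpair_eqE eqxx andbT.
rewrite Ek det_masked_shift {1}/slice inE.
have El (S : {set V}) :
     \prod_(l | l != k)
       \det (masked A (fun i' => z (i', l) + t *+ ((i', l) == (i, k))) (slice S l)) =
     \prod_(l | l != k) \det (masked A (fun i' => z (i', l)) (slice S l)).
  apply: eq_bigr => l lk; congr (\det (masked _ _ _)); apply: funext => i'.
  by rewrite xpair_eqE (negbTE lk) andbF addr0.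
rewrite El; case: ifP => // ikU; rewrite mulrDl -mulrA; congr (_ + _ * (_ * _)).
  congr (\det (masked _ _ _)); apply/setP => i'.
  by rewrite !inE xpair_eqE eqxx andbT.
apply: eq_bigr => l lk; congr (\det (masked _ _ _)); apply/setP => i'.
by rewrite !inE xpair_eqE (negbTE lk) andbF.
Qed.

Lemma minors_diag U (b : R) : minors U (fun=> b%:C) = (\prod_k rdet A b (slice U k))%:C.
Proof. by rewrite rmorph_prod; apply: eq_bigr => k _; rewrite rdetE. Qed.

Lemma evC_minors U z : evC (pd U minors_coef) z = minors U z.
Proof.
apply: ev_derivative_system => {}U; first exact: minors_shift.
by rewrite /minors_coef -[0]/(0%:C) minors_diag.
Qed.

Lemma evR_minors U (b : R) :
  evR (pd U minors_coef) (fun=> b) = \prod_k rdet A b (slice U k).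
Proof. by apply: (@complexI R); rewrite -evC_real evC_minors minors_diag. Qed.

Lemma minors_stable : stable [set: V] minors_coef.
Proof.
move=> U _ z z0; rewrite evC_minors; apply/prodf_neq0 => k _.
by apply: det_masked_upper => // i; apply: z0.
Qed.

Lemma minors_leading : leading [set: V] #|{: V}| 1 minors_coef.
Proof.
split=> [|U _]; first by rewrite cardsT.
have dE : diag (pd U minors_coef) =
    \sum_(S : {set V} | S \subset ~: U) minors_coef (U :|: S) *: 'X^#|S|.
  rewrite /diag /ev [RHS]big_mkcond; apply: eq_bigr => S _.
  rewrite prodr_const mul_polyC /pd disjoint_sym disjoints_subset.
  by case: ifP => _; rewrite ?scale0r.
have cU : (#|{: V}| - #|U|)%N = #|~: U| by rewrite -(cardsC U) addKn.
rewrite dE cU; split.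
  apply: leq_trans (size_sum _ _ _) _; apply/bigmax_leqP => S SU.
  apply: leq_trans (size_scale_leq _ _) _.
  by rewrite size_polyXn ltnS subset_leq_card.
(* Only the full set of variables contributes in top degree, and there each factor is the
   determinant of the identity. *)
rewrite coef_sum (bigD1 (~: U)) //= coefZ coefXn eqxx mulr1 setUCr big1 ?addr0.
  rewrite /minors_coef /minors big1 // => k _.
  rewrite (_ : slice _ _ = [set: 'I_n]) ?det_masked_setT //.
  by apply/setP => i; rewrite !inE.
move=> S /andP[SU SnU]; rewrite coefZ coefXn (negbTE (_ : #|~: U| != #|S|)) ?mulr0 //.
by apply: contra SnU => /eqP E; rewrite eqEcard SU E leqnn.
Qed.

Hypothesis contr : forall u, n2 (A *m u) <= n2 u.
Hypothesis A0 : forall i, A i i = 0.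

(** Differentiating in [(i, k)] changes only the factor of colour [k], which [rdet_barrier]
    controls. One value of the barrier serves all [b' >= b] because [b - 1 / b] increases. *)
Lemma minors_barrier (b b' : R) : 1 < b -> b <= b' ->
  barrier [set: V] (b - b^-1) minors_coef (fun=> b').
Proof.
move=> b1 bb'; have b'1 : 1 < b' by apply: lt_le_trans bb'.
split=> [U _|[i k] _].
  by rewrite evR_minors prodr_gt0 // => k _; apply: rdet_gt0.
rewrite -[X in _ <= ev _ X _]pd0 !evR_minors.
rewrite (bigD1 k) //= [X in _ <= X](bigD1 k) //= mulrA.
have E0 l : slice set0 l = set0 by apply/setP => j; rewrite !inE.
have Ek : slice [set (i, k)] k = [set i].
  by apply/setP => j; rewrite !inE xpair_eqE eqxx andbT.
have -> : \prod_(l | l != k) rdet A b' (slice [set (i, k)] l) =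
          \prod_(l | l != k) rdet A b' (slice set0 l).
  apply: eq_bigr => l lk; congr (rdet _ _ _); apply/setP => j.
  by rewrite !inE xpair_eqE (negbTE lk) andbF.
rewrite ler_wpM2r //; first by apply: prodr_ge0 => l _; apply/ltW/rdet_gt0.
rewrite Ek E0; apply: le_trans (rdet_barrier HA contr A0 i b'1).
rewrite ler_wpM2r //; first exact/ltW/rdet_gt0.
have b0 : 0 < b by apply: lt_trans b1.
by rewrite lerB // lef_pV2 // posrE // (lt_le_trans b0).
Qed.

Lemma colouring_minors (b : R) : (1 < r)%N -> 1 < b ->
  exists sigma : 'I_n -> 'I_r, forall x k,
    b - (b - b^-1) * (1 - 2 / r%:R) <= x ->
    rdet A x [set i | sigma i != k] != 0.
Proof.
move=> r1 b1; set t := _ * (1 - _).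
have b0 : 0 < b by apply: lt_trans b1.
have s0 : 0 < b - b^-1 by rewrite subr_gt0 (lt_trans _ b1) // invf_lt1.
have allr : rows r (enum 'I_n) = [set: V].
  by apply/setP => p; rewrite !inE mem_enum.
have [|sigma pos] := @choose_colours R n r [set: V] _ 1 (b - t) (enum 'I_n) minors_coef
  (ltnW r1) (enum_uniq _) (subsetT _) ltr01 minors_stable minors_leading.
  (* For positivity at [x], start the barrier at [x + t]: the averages lower every variable by
     [t]. *)
  move=> x bx; have bx' : b <= x + t by rewrite -lerBlDr.
  have [+ _] := avgs_barrier r1 (enum_uniq 'I_n) (subsetT _) ltr01 s0 minors_stable
    minors_leading (minors_barrier b1 bx').
  move=> /(_ set0 (sub0set _)); rewrite pd0 allr -/t.
  by rewrite (_ : lower _ _ _ = fun=> x) //; apply: funext => p; rewrite /lower inE addrK.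
exists sigma => x k bx; have := pos x bx; rewrite evR_minors.
move=> /gt_eqF/negbT/prodf_neq0/(_ k isT).
rewrite (_ : slice _ _ = [set i | sigma i != k]) //.
by apply/setP => i; rewrite !inE mem_enum /= eq_sym.
Qed.

End OneSided.

(** * Numerical range and operator norm *)

Section Spectral.
Variables (R : rcfType) (n : nat).
Local Open Scope complex_scope.
Notation toC := (real_complex R).
Implicit Types (A B : 'M[R[i]]_n) (u v : 'cV[R[i]]_n).

(** The conjugate transpose, as opposed to the adjugate [\adj]. *)
Definition adj B : 'M[R[i]]_n := map_mx (@conjc R) B^T.

Lemma dot_adj B u v : dot u (adj B *m v) = dot (B *m u) v.
Proof.
rewrite /dot; under eq_bigr => i _ do rewrite mxE mulr_sumr.
rewrite exchange_big /=; apply: eq_bigr => j _.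
rewrite mxE conjc_sum mulr_suml; apply: eq_bigr => i _.
by rewrite !mxE conjcM; ring.
Qed.

Lemma hermitianP B : reflect (hermitian B) (B \is hermsymmx).
Proof.
apply: (iffP (is_hermitianmxP _ _ _)); rewrite expr0 scale1r.
  by move=> E i j; rewrite {1}E !mxE.
by move=> H; apply/matrixP => i j; rewrite !mxE H.
Qed.

(* If all the eigenvalues of the compression of [A] to the complement of [S] are
   below [b], so is its numerical range. *)
Lemma quad_le_rdet A (S : {set 'I_n}) (b : R) u : hermitian A -> 0 < b ->
  (forall x, b <= x -> rdet A x S != 0) ->
  (forall i, i \in S -> u i 0 = 0) -> quad A u <= b * n2 u.
Proof.
move=> HA b0 Hdet uS.
pose H : 'M[R[i]]_n := \matrix_(i, j) if (i \in S) || (j \in S) then 0 else A i j.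
have HH : hermitian H.
  by move=> i j; rewrite !mxE orbC; case: ifP => _; rewrite ?conjc0 // HA.
have /hermitianP Hh := HH.
have /orthomx_spectralP EH := hermitian_normalmx Hh.
set P := spectralmx H in EH; set d := spectral_diag H in EH.
have Pu : P \is unitarymx by apply: spectral_unitarymx.
have Puni : P \in unitmx by apply: spectral_unit.
have iP : invmx P = adj P by rewrite invmx_unitary.
have dreal i : d 0 i = (rec (d 0 i))%:C.
  by have /mxOverP/(_ 0 i) := hermitian_spectral_diag_real Hh; move/RRe_real => ->.
have PH : P *m H = diag_mx d *m P by rewrite {1}EH !mulmxA mulmxV // mul1mx.
have d_lt i : rec (d 0 i) < b.
  rewrite ltNge; apply/negP => bd; set x := rec _ in bd.
  pose w := row i P.
  have wH : w *m H = x%:C *: w.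
    by apply/rowP => j; rewrite /w -row_mul PH mul_diag_mx !mxE -dreal.
  have w0 : w != 0.
    apply/negP => /eqP w0; have : w *m invmx P = delta_mx 0 i.
      by rewrite /w -row_mul mulmxV // row1.
    rewrite w0 mul0mx => /rowP/(_ i); rewrite !mxE !eqxx => /eqP.
    by rewrite eq_sym oner_eq0.
  (* The columns of [H] at [S] are zero, so an eigenvector with eigenvalue [x >= b > 0] vanishes
     there and lies in the kernel of the masked matrix at [x]. *)
  clearbody w; have x0 : x%:C != 0 :> R[i].
    by apply/eqP => -[E]; rewrite E in bd; have := lt_le_trans b0 bd; rewrite ltxx.
  have wS j : j \in S -> w 0 j = 0.
    move=> jS; apply: (mulfI x0); rewrite mulr0.
    move/rowP/(_ j): wH; rewrite !mxE => <-.
    by rewrite big1 // => k _; rewrite !mxE jS orbT mulr0.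
  have := Hdet x bd; apply/negP; rewrite negbK.
  suff : \det (masked A (fun=> x%:C) S) == 0 by rewrite rdetE // => /eqP[->].
  apply/det0P; exists w => //; apply/rowP => j; rewrite !mxE.
  have [jS|jS] := boolP (j \in S).
    rewrite big1 // => k _; rewrite [masked _ _ _ _ _]mxE jS orbT.
    by case: (eqVneq k j) => [->|_]; rewrite ?mulr0 // wS ?mul0r.
  transitivity (\sum_k w 0 k * (x%:C *+ (k == j) - H k j)).
    apply: eq_bigr => k _; rewrite !mxE (negbTE jS) orbF.
    by case: ifP => // kS; rewrite (wS _ kS) !mul0r.
  under eq_bigr => k _ do rewrite mulrBr.
  rewrite sumrB (bigD1 j) //= eqxx big1 ?addr0 => [|k /negbTE->]; last by rewrite mulr0.
  by move/rowP/(_ j): wH; rewrite !mxE => ->; rewrite mulr1n mulrC subrr.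
have -> : quad A u = quad H u.
  rewrite /quad; congr (complex.Re _); apply: eq_bigr => i _; rewrite !mxE.
  have [iS|iS] := boolP (i \in S); first by rewrite uS // conjc0 !mul0r.
  congr (_ * _); apply: eq_bigr => j _; rewrite mxE (negbTE iS) /=.
  by case: ifP => // jS; rewrite uS // !mulr0.
rewrite /quad EH iP -!mulmxA dot_adj.
have <- : n2 (P *m u) = n2 u.
  by apply: (@complexI R); rewrite -!dot_n2 -dot_adj mulmxA -iP mulVmx // mul1mx.
set v := P *m u; rewrite mul_diag_mx.
have -> : dot v (\matrix_(i, j) (d 0 i * v i j)) = (\sum_i rec (d 0 i) * normc2 (v i 0))%:C.
  rewrite rmorph_sum; apply: eq_bigr => i _.
  transitivity ((rec (d 0 i))%:C * (v i 0 * cj (v i 0))); last by rewrite mulcJ -rmorphM.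
  by rewrite -dreal [X in _ * X]mxE; ring.
rewrite /= mulr_sumr; apply: ler_sum => i _.
by rewrite ler_wpM2r ?normc2_ge0 // ltW.
Qed.

Lemma one_sided_paving A r (b : R) : (1 < r)%N -> 1 < b ->
  hermitian A -> (forall u, n2 (A *m u) <= n2 u) -> (forall i, A i i = 0) ->
  exists sigma : 'I_n -> 'I_r, forall k u, (forall i, sigma i != k -> u i 0 = 0) ->
    quad A u <= (b - (b - b^-1) * (1 - 2 / r%:R)) * n2 u.
Proof.
move=> r1 b1 HA cA A0; have [sigma H] := colouring_minors HA cA A0 r1 b1.
exists sigma => k u uk; set g := b - _.
apply: (quad_le_rdet (S := [set i | sigma i != k]) HA) => [|x gx|i].
- have b0 : 0 < b by apply: lt_trans b1.
  have rr : 0 < r%:R :> R by rewrite ltr0n ltnW.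
  have -> : g = b^-1 + (b - b^-1) * (2 / r%:R) by rewrite /g; ring.
  rewrite ltr_wpDr ?invr_gt0 //; apply: mulr_ge0; last by rewrite divr_ge0 // ltW.
  by rewrite subr_ge0 ltW // (lt_trans _ b1) // invf_lt1.
- exact: H.
- by rewrite inE => /uk.
Qed.

End Spectral.

(** * Operator norm and compressions *)

Section OperatorNorm.
Variables (R : realType) (n : nat).
Local Open Scope complex_scope.
Implicit Types (B T : 'M[R[i]]_n) (u v : 'cV[R[i]]_n).

Lemma normc_sqr (x : R[i]) : ComplexField.Normc.normc x ^+ 2 = normc2 x.
Proof. by case: x => a b; rewrite sqr_sqrtr // addr_ge0 ?sqr_ge0. Qed.

Lemma l2normE u : l2norm u = Num.sqrt (n2 u).
Proof. by congr Num.sqrt; apply: eq_bigr => i _; rewrite normc_sqr. Qed.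

Lemma n2_0 : n2 (0 : 'cV[R[i]]_n) = 0.
Proof.
rewrite /n2 big1 // => i _; rewrite mxE; apply/eqP.
by rewrite normc2_eq0.
Qed.

Lemma l2norm0_le1 : l2norm (0 : 'cV[R[i]]_n) <= 1.
Proof. by rewrite l2normE n2_0 sqrtr0 ler01. Qed.

Lemma l2norm_le1 u : (l2norm u <= 1) = (n2 u <= 1).
Proof. by rewrite l2normE -[X in _ <= X]sqrtr1 ler_sqrt ?ler01. Qed.

Lemma opnorm_le B (g : R) : 0 <= g -> (forall u, n2 (B *m u) <= g ^+ 2 * n2 u) ->
  opnorm B <= g.
Proof.
move=> g0 H; apply: sup_le_ub => [|_ [u u1 <-]].
  by exists (l2norm (B *m 0)), 0 => //=; apply: l2norm0_le1.
have {}u1 : n2 u <= 1 by rewrite -l2norm_le1.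
rewrite l2normE -[g]ger0_norm // -sqrtr_sqr ler_sqrt ?sqr_ge0 //.
by apply: le_trans (H u) _; rewrite ler_piMr ?sqr_ge0.
Qed.

Lemma normc_coord_le (u : 'cV[R[i]]_n) i : n2 u <= 1 ->
  ComplexField.Normc.normc (u i 0) <= 1.
Proof.
move=> u1; rewrite -(@ler_pXn2r _ 2) ?nnegrE ?ler01 //; 
  last by case: (u i 0) => *; apply: sqrtr_ge0.
by rewrite normc_sqr expr1n (le_trans (n2_ge_coord u i)).
Qed.

(** [sup] is meaningful only for a bounded nonempty set. The row sums of moduli give a crude bound,
    as the coordinates of a vector in the unit ball have modulus at most 1. *)
Lemma opnorm_has_sup B :
  has_sup [set l2norm (B *m x) | x in [set x : 'cV[R[i]]_n | l2norm x <= 1]]%classic.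
Proof.
split.
  by exists (l2norm (B *m 0)), 0 => //=; apply: l2norm0_le1.
pose nc (x : R[i]) := ComplexField.Normc.normc x.
have nc0 x : 0 <= nc x by case: x => a b; apply: sqrtr_ge0.
exists (Num.sqrt (\sum_i (\sum_j nc (B i j)) ^+ 2)) => _ [u u1 <-].
have {}u1 : n2 u <= 1 by rewrite -l2norm_le1.
rewrite ler_wsqrtr //; apply: ler_sum => i _.
rewrite ler_pXn2r ?nnegrE ?sumr_ge0 //.
rewrite mxE; apply: le_trans (_ : \sum_j nc (B i j * u j 0) <= _).
  elim/big_ind2: _ => //; first by rewrite /nc ComplexField.Normc.normc0.
  by move=> x1 x2 y1 y2 h1 h2; apply: le_trans (le_normcD _ _) (lerD h1 h2).
apply: ler_sum => j _; rewrite /nc ComplexField.Normc.normcM ler_piMr //.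
exact: normc_coord_le.
Qed.

Lemma opnorm_ub B u : l2norm u <= 1 -> l2norm (B *m u) <= opnorm B.
Proof.
by move=> u1; apply: ub_le_sup; [case: (opnorm_has_sup B) | exists u].
Qed.

Lemma opnorm_ge0 B : 0 <= opnorm B.
Proof.
by apply: le_trans (opnorm_ub B l2norm0_le1); rewrite l2normE sqrtr_ge0.
Qed.

Lemma n2Z (a : R) u : n2 (a%:C *: u) = a ^+ 2 * n2 u.
Proof.
apply: (@complexI R); rewrite -dot_n2 dotZl dotZr dot_n2 -!rmorphM /=.
by congr (_ %:C); ring.
Qed.

Lemma opnorm_n2 B u : n2 (B *m u) <= opnorm B ^+ 2 * n2 u.
Proof.
have [u0|u0] := lerP (n2 u) 0.
  by rewrite (n2_eq0 u0) mulmx0 n2_0 mulr0.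
pose a := (Num.sqrt (n2 u))^-1; have a2 : a ^+ 2 = (n2 u)^-1.
  by rewrite exprVn sqr_sqrtr // ltW.
have : l2norm (B *m (a%:C *: u)) <= opnorm B.
  by apply: opnorm_ub; rewrite l2normE n2Z a2 mulVf ?gt_eqF // sqrtr1.
rewrite l2normE -scalemxAr n2Z a2 -(@ler_pXn2r _ 2) ?nnegrE ?sqrtr_ge0 ?opnorm_ge0 //.
rewrite sqr_sqrtr; last by rewrite mulr_ge0 ?invr_ge0 ?n2_ge0.
by rewrite mulrC ler_pdivrMr.
Qed.

Lemma n2N u : n2 (- u) = n2 u.
Proof.
apply: eq_bigr => i _; rewrite mxE; case: (u i 0) => a c.
by rewrite /normc2 /= !sqrrN.
Qed.

Definition coord (S : {set 'I_n}) : 'M[R[i]]_n := diag_mx (\row_i (i \in S)%:R).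

Lemma coordE S i j : coord S i j = ((i == j) && (i \in S))%:R.
Proof. by rewrite !mxE; case: eqP => [->|]; rewrite ?mulr1n. Qed.

Lemma coord_projP S : coord_proj (coord S).
Proof.
split; first exact: diag_mx_is_diag.
by move=> i; rewrite coordE eqxx; case: (i \in S); [right|left].
Qed.

Lemma coord_mul S u i : (coord S *m u) i 0 = if i \in S then u i 0 else 0.
Proof. by rewrite mul_diag_mx !mxE; case: ifP => _; rewrite ?mul1r ?mul0r. Qed.

Lemma n2_coord S u : n2 (coord S *m u) <= n2 u.
Proof.
apply: ler_sum => i _; rewrite coord_mul; case: ifP => // _.
by rewrite (_ : normc2 0 = 0) ?normc2_ge0 //; apply/eqP; rewrite normc2_eq0.
Qed.

Lemma coord_herm S : hermitian (coord S).
Proof.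
move=> i j; rewrite !coordE eq_sym conjc_nat.
by case: eqP => [->|].
Qed.

Lemma hermitian_compress T S : hermitian T -> hermitian (coord S *m T *m coord S).
Proof.
move=> HT i j.
have E k l : (coord S *m T *m coord S) k l =
    if (k \in S) && (l \in S) then T k l else 0.
  rewrite mul_mx_diag mxE mul_diag_mx !mxE.
  by case: (k \in S); case: (l \in S); rewrite ?mul1r ?mulr1 ?mul0r ?mulr0.
by rewrite !E andbC; case: ifP => _; rewrite ?conjc0.
Qed.

Lemma quad_compress T S u :
  quad (coord S *m T *m coord S) u = quad T (coord S *m u).
Proof. by rewrite /quad -!mulmxA (dot_herm (coord_herm S)). Qed.

(** Covers [eps >= 1] and [opnorm T = 0]: the first block is everything, the others are empty. *)
Lemma trivial_paving r T (eps : R) : (0 < r)%N -> opnorm T <= eps * opnorm T ->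
  can_be_paved r eps T.
Proof.
case: r => // r _ leT; exists (fun k => coord (if k == ord0 then [set: 'I_n] else set0)); split.
- by move=> k; apply: coord_projP.
- apply/matrixP => i j; rewrite summxE (bigD1 ord0) //= big1 ?addr0 => [|k /negbTE->].
    by rewrite coordE inE andbT mxE.
  by rewrite coordE inE andbF.
- move=> k; apply: le_trans leT; apply: opnorm_le (opnorm_ge0 T) _ => u.
  rewrite -!mulmxA; apply: le_trans (n2_coord _ _) _; apply: le_trans (opnorm_n2 _ _) _.
  by rewrite ler_wpM2l ?sqr_ge0 // n2_coord.
Qed.

End OperatorNorm.

(** * Assembling the two-sided paving *)

Unset Implicit Arguments.

Theorem theorem6p1 (R : realType) (eps : R) (n : nat) (T : 'M[R[i]]_n) :
  0 < eps -> (0 < n)%N ->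
  T \is hermsymmx -> (forall i : 'I_n, T i i = 0) ->
  can_be_paved `|Num.ceil ((6 / eps) ^+ 4)|%N eps T.
Proof.
move=> e0 n0 /hermitianP HT T0; set N := `|_|%N.
have N_ge : (6 / eps) ^+ 4 <= N%:R.
  apply: le_trans (ceil_ge _) _.
  by rewrite -[N%:R]/(N%:Z%:~R) ler_int /N abszE ler_norm.
have six0 : 0 < 6 / eps by rewrite divr_gt0.
have N0 : (0 < N)%N by rewrite -(ltr_nat R) (lt_le_trans _ N_ge) // exprn_gt0.
set M := opnorm T; have M_ge0 : 0 <= M by apply: opnorm_ge0.
have [e1|e1] := leP 1 eps; first by apply: trivial_paving; rewrite // ler_peMl.
have [M0|M0] := leP M 0.
  by apply: trivial_paving; rewrite // (_ : opnorm T = 0) ?mulr0 //; apply: le_anti; rewrite M0.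
(* Dividing by the norm makes [A] a contraction; [x] is the square root of [(6 / eps) ^+ 4], and its
   floor will be the number of colours on each side. *)
pose A : 'M[R[i]]_n := (M^-1)%:C%C *: T; pose x : R := 36 / eps ^+ 2.
have en : eps != 0 by rewrite gt_eqF.
have e2 : 0 < eps ^+ 2 by rewrite exprn_gt0.
have e21 : eps ^+ 2 <= 1 by rewrite exprn_ile1 ?ltW.
have x0 : 0 <= x by rewrite divr_ge0 // ltW.
have [q [qx xq]] : exists q : nat, q%:R <= x /\ x < q%:R + 1.
  by exists (Num.truncn x); rewrite -truncn_ge_nat // leqnn natr1 truncnS_gt.
have qq : (q * q <= N)%N.
  rewrite -(ler_nat R) natrM; apply: le_trans N_ge.
  have -> : (6 / eps) ^+ 4 = x * x by rewrite /x; field.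
  by rewrite ler_pM.
(* Since [eps <= 1], one unit of [1 / eps ^+ 2] pays for rounding [x] down. *)
have x36 : 35 / eps ^+ 2 + 1 <= x.
  have -> : x = 35 / eps ^+ 2 + 1 / eps ^+ 2 by rewrite /x -mulrDl; congr (_ / _); ring.
  by rewrite lerD2l ler_pdivlMr // mul1r.
have q35 : 35 / eps ^+ 2 <= q%:R by lra.
have q1 : (1 < q)%N.
  rewrite -(ltr_nat R); apply: lt_le_trans q35.
  by rewrite ltr_pdivlMr //; lra.
have q0 : 0 < q%:R :> R by rewrite ltr0n ltnW.
pose b := 3 / eps.
have b1 : 1 < b by rewrite ltr_pdivlMr // mul1r (lt_trans e1) //; lra.
(* The two parts of the bound are [eps / 3] and at most [6 / 35 * eps]. *)
have bound : b - (b - b^-1) * (1 - 2 / q%:R) <= eps.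
  have -> : b - (b - b^-1) * (1 - 2 / q%:R) = b^-1 + (b - b^-1) * (2 / q%:R) by ring.
  have bV : b^-1 = eps / 3 by rewrite /b invf_div.
  have q2 : 2 / q%:R <= 2 * eps ^+ 2 / 35.
    rewrite ler_pdivrMr //; move: q35; rewrite ler_pdivrMr //; lra.
  have : (b - b^-1) * (2 / q%:R) <= b * (2 * eps ^+ 2 / 35).
    apply: ler_pM => //; first by rewrite bV; lra.
      by rewrite divr_ge0 // ltW.
    by rewrite lerBlDr lerDl bV divr_ge0 // ltW.
  have -> : b * (2 * eps ^+ 2 / 35) = 6 / 35 * eps by rewrite /b; field.
  by rewrite bV; lra.
have HA : hermitian A by move=> i j; rewrite !mxE HT conjcM conjc_real.
have HNA : hermitian (- A) by move=> i j; rewrite mxE [in RHS]mxE HA rmorphN.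
have cA u : n2 (A *m u) <= n2 u.
  rewrite -scalemxAl n2Z exprVn mulrC ler_pdivrMr ?exprn_gt0 // mulrC.
  exact: opnorm_n2.
have cNA u : n2 (- A *m u) <= n2 u.
  by rewrite mulNmx n2N.
have A0 i : A i i = 0 by rewrite mxE T0 mulr0.
have NA0 i : (- A) i i = 0 by rewrite mxE A0 oppr0.
have [s1 H1] := one_sided_paving q1 b1 HA cA A0.
have [s2 H2] := one_sided_paving q1 b1 HNA cNA NA0.
(* The pair of colours is written in base [q], which gives a number below [q * q <= N]. *)
pose colour i : nat := (s1 i * q + s2 i)%N.
have colour_lt i : (colour i < N)%N.
  apply: leq_trans qq; apply: leq_trans (_ : (s1 i).+1 * q <= _)%N.
    by rewrite /colour mulSn addnC ltn_add2r.
  by rewrite leq_mul2r ltn_ord orbT.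
have colourK i j : colour i = colour j -> s1 i = s1 j /\ s2 i = s2 j.
  rewrite /colour => E; split; apply: val_inj => /=.
    by have := congr1 (divn^~ q) E; rewrite !divnMDl ?(ltnW q1) // !divn_small // !addn0.
  by have := congr1 (modn^~ q) E; rewrite !modnMDl !modn_small.
exists (fun k => coord R [set i | colour i == k :> nat]); split.
- by move=> k; apply: coord_projP.
- apply/matrixP => i j; rewrite summxE (bigD1 (Ordinal (colour_lt i))) //= big1 ?addr0.
    by rewrite coordE inE eqxx andbT mxE.
  move=> k; rewrite -val_eqE /= eq_sym => /negbTE ki.
  by rewrite coordE inE ki andbF.
move=> k; set S := [set i | _]; have eM : 0 < eps * M by rewrite mulr_gt0.
(* The compression is Hermitian, so a two-sided bound on its quadratic form suffices. *)
apply: opnorm_le (ltW eM) _ => u; apply: n2_le_quad => //; first exact: hermitian_compress.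
move=> v; rewrite quad_compress; set w := _ *m v.
have wv : n2 w <= n2 v by apply: n2_coord.
have quadA : quad T w = M * quad A w.
  apply: (@complexI R); rewrite rmorphM /= -!dot_quad // -scalemxAl dotZr mulrA.
  by rewrite -rmorphM divff ?gt_eqF // mul1r.
have quadNA : quad (- A) w = - quad A w.
  by rewrite /quad mulNmx dotNr; case: (dot _ _).
have main : - (eps * n2 v) <= quad A w <= eps * n2 v.
  have [i0 i0S|S0] := pickP (mem S); last first.
    have -> : w = 0.
      by apply/colP => i; rewrite coord_mul mxE; have := S0 i; rewrite /= => ->.
    rewrite /quad mulmx0 (_ : dot 0 0 = 0) /=; last by rewrite dot_n2 n2_0.
    by rewrite oppr_le0 andbb mulr_ge0 ?n2_ge0 // ltW.
  have supp i : w i 0 != 0 -> s1 i = s1 i0 /\ s2 i = s2 i0.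
    rewrite coord_mul; case: ifP => [|_]; last by rewrite eqxx.
    move: i0S; rewrite !inE => /eqP E0 /eqP E1 _.
    by apply: colourK; rewrite E0 E1.
  have h1 := H1 (s1 i0) w; have h2 := H2 (s2 i0) w.
  have le_eps z : z <= (b - (b - b^-1) * (1 - 2 / q%:R)) * n2 w -> z <= eps * n2 v.
    move=> h; apply: le_trans h _; apply: le_trans (ler_wpM2r (n2_ge0 w) bound) _.
    by rewrite ler_wpM2l // ltW.
  have {}h1 : quad A w <= eps * n2 v.
    apply/le_eps/h1 => i ik; apply/eqP; apply: contraR ik => /supp[-> _].
    by rewrite eqxx.
  have {}h2 : quad (- A) w <= eps * n2 v.
    apply/le_eps/h2 => i ik; apply/eqP; apply: contraR ik => /supp[_ ->].
    by rewrite eqxx.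
  by rewrite h1 andbT lerNl -quadNA.
rewrite quadA [eps * M]mulrC -mulrA -mulrN !ler_pM2l //.
Qed.
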